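(* Let $m \ge 1$ be an integer and let $(p_0,\ldots,p_m)$ be a probability vector with $p_i>0$ for all $0\le i\le m$. Let $\mathbb{X}_m \subset \{a,b\}^{\mathbb{Z}}$ be the two-sided discrete hull of the random noble means substitution $\zeta_m$ with probabilities $(p_0,\ldots,p_m)$, let $S$ be the shift on $\mathbb{X}_m$, and let $\mu$ be the shift-invariant probability measure on $\mathbb{X}_m$ determined by $\mu(Z_k(v)) = \phi^{(\ell)}(v)$ for all $\ell\ge 1$, all legal words $v$ of length $\ell$ and all positions $k$ (with $Z_k(v)$ and $\phi^{(\ell)}$ as defined in the context). Then, for any $f \in L^1(\mathbb{X}_m,\mu)$ and for an arbitrary but fixed $s\in\mathbb{Z}$, the identity $$\lim_{N\to\infty} \frac{1}{N}\sum_{i=s}^{N+s-1} f(S^i x) = \int_{\mathbb{X}_m} f \,\mathrm{d}\mu$$ holds for $\mu$-almost every $x\in\mathbb{X}_m$.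
   Context: Alphabet and random substitution. Let $\mathcal{A}=\{a,b\}$, let $m\ge 1$ be an integer and let $(p_0,\ldots,p_m)$ be a probability vector with all $p_i>0$. The random noble means substitution $\zeta_m$ maps $b\mapsto a$ and maps $a \mapsto a^i b a^{m-i}$ with probability $p_i$, for $0\le i\le m$. It is extended to words by concatenation and applied locally: for each occurrence of the letter $a$ in a word, one of the $m+1$ images is chosen independently, so the image of a word is a random word, and $\zeta_m^k(a)$ is a random word for each $k\in\mathbb{N}$. A realisation of $\zeta_m^k(a)$ is any word attained with positive probability; similarly for $\zeta_m(w)$. Legal words. A finite word is legal (with respect to $\zeta_m$) if it is a subword (contiguous factor) of some realisation of $\zeta_m^k(a)$ for some $k\in\mathbb{N}$. Let $\mathcal{D}_{m,\ell}$ be the set of all legal words of length $\ell$. Hull. $\mathcal{A}^{\mathbb{Z}}$ carries the product topology of the discrete topology on $\mathcal{A}$, and the shift is $(Sx)_i = x_{i+1}$. The two-sided discrete hull $\mathbb{X}_m$ is the closed shift-invariant set of all $x\in\mathcal{A}^{\mathbb{Z}}$ all of whose finite subwords are legal with respect to $\zeta_m$. Notation. For a finite or bi-infinite word $w$, $w_{[i,j]}$ denotes the subword $w_i w_{i+1}\cdots w_j$; a finite word of length $\ell$ is indexed as $w=w_0w_1\cdots w_{\ell-1}$; $|w|$ is the length of $w$. Induced substitution and its matrix. For $\ell\ge 2$, the induced substitution $\zeta_{m,(\ell)}$ on the alphabet $\mathcal{D}_{m,\ell}$ is the random substitution sending $w\in\mathcal{D}_{m,\ell}$, for each realisation $v$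 of $\zeta_m(w)$, to the finite sequence of length-$\ell$ words $\bigl(v_{[k,k+\ell-1]}\bigr)_{0\le k\le |\zeta_m(w_0)|-1}$, with probability equal to the probability of the realisation $v$ of $\zeta_m(w)$. (Here $|\zeta_m(a)|=m+1$ and $|\zeta_m(b)|=1$ for every realisation.) For $\ell=1$, $\zeta_{m,(1)}=\zeta_m$. The substitution matrix $M_{m,\ell}$ has rows and columns indexed by $\mathcal{D}_{m,\ell}$ (in lexicographic order), and its entry in row $u$ and column $w$ is the expected number of occurrences of the word $u$ in the sequence $\zeta_{m,(\ell)}(w)$. In particular $M_{m,1}=\begin{pmatrix} m & 1\\ 1 & 0\end{pmatrix}$. Each $M_{m,\ell}$ is a primitive matrix with Perron–Frobenius eigenvalue $\lambda_m=\frac12\bigl(m+\sqrt{m^2+4}\bigr)$. Let $\phi^{(\ell)}$ be the strictly positive right eigenvector of $M_{m,\ell}$ for the eigenvalue $\lambda_m$, normalised so that its entries sum to $1$, and let $\phi^{(\ell)}(v)$ be its entry at $v\in\mathcal{D}_{m,\ell}$. Measure. For $v\in\mathcal{D}_{m,\ell}$ and $k\in\mathbb{Z}$, the cylinder set is $Z_k(v)=\{w\in\mathbb{X}_m : w_{[k,k+\ell-1]}=v\}$. The prescription $\mu(Z_k(v))=\phi^{(\ell)}(v)$ is consistent and defines a shift-invariant Borel probability measure $\mu$ on $\mathbb{X}_m$. *)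

(* Defs.v *)
From mathcomp Require Import all_boot all_order all_algebra.
From mathcomp Require Import all_classical all_reals all_analysis.

Set Implicit Arguments.
Unset Strict Implicit.
Unset Printing Implicit Defensive.

Import Order.TTheory GRing.Theory Num.Theory.
Import numFieldNormedType.Exports.

Local Open Scope classical_set_scope.
Local Open Scope ring_scope.

Notation letter := bool (only parsing).
Notation a_ := true (only parsing).
Notation b_ := false (only parsing).
Notation word := (seq letter) (only parsing).

(* The law of a random variable with finitely many outcomes, as a list of
   weighted outcomes; the same outcome may occur several times, in which case
   its weights add up. *)
Definition law (R : realType) (T : Type) := seq (R * T).

Section law.
Context {R : realType}.

Definition lret {T : Type} (x : T) : law R T := [:: (1, x)].

Definition lbind {T U : Type} (X : law R T) (F : T -> law R U) : law R U :=
  flatten [seq [seq (qx.1 * ry.1, ry.2) | ry <- F qx.2] | qx <- X].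

Definition lmap {T U : Type} (g : T -> U) (X : law R T) : law R U :=
  [seq (qx.1, g qx.2) | qx <- X].

Definition prob {T : eqType} (X : law R T) (x : T) : R :=
  \sum_(qy <- X | qy.2 == x) qy.1.

Definition expect {T : Type} (X : law R T) (g : T -> R) : R :=
  \sum_(qx <- X) qx.1 * g qx.2.

Definition realisation {T : eqType} (X : law R T) (x : T) : Prop :=
  0 < prob X x.

End law.

Section noble_means.
Context {R : realType} {m : nat} (p : 'I_m.+1 -> R).

Definition zeta_letter (x : letter) : law R word :=
  if x == a_
  then [seq (p i, nseq i a_ ++ b_ :: nseq (m - i) a_) | i : 'I_m.+1]
  else lret [:: a_].

(* The product of the weights makes the choices for distinct occurrences of
   the letter a independent. *)
Fixpoint zeta (w : word) : law R word :=
  if w is x :: w'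
  then lbind (zeta_letter x) (fun u => lmap (cat u) (zeta w'))
  else lret [::].

Definition zeta_iter (k : nat) (w : word) : law R word :=
  iter k (fun X => lbind X zeta) (lret w).

Definition legal (w : word) : Prop :=
  exists k v, realisation (zeta_iter k [:: a_]) v /\ infix w v.

Definition legal_words (l : nat) : {set l.-tuple letter} :=
  finset (fun w : l.-tuple letter => `[< legal w >]).

(* The common length of all realisations of zeta_letter x. *)
Definition zeta_len (x : letter) : nat := if x == a_ then m.+1 else 1.

(* The induced substitution on words of length l >= 1. For l = 1 it cuts the
   realisations of zeta into single letters, that is, it is zeta itself. *)
Definition induced_zeta (l : nat) (w : word) : law R (seq word) :=
  lmap (fun v => [seq take l (drop k v) | k <- iota 0 (zeta_len (head a_ w))])
       (zeta w).

Definition legal_word (l : nat) (i : 'I_#|legal_words l|) : word :=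
  tval (enum_val i).

Definition subst_mx (l : nat) : 'M[R]_#|legal_words l| :=
  \matrix_(i, j) expect (induced_zeta l (legal_word j))
                        (fun s => (count_mem (legal_word i) s)%:R).

End noble_means.

Definition lambda {R : realType} (m : nat) : R :=
  (m%:R + Num.sqrt (m%:R ^+ 2 + 4)) / 2.

Definition normalised_pf_vector {R : realType} {n : nat} (M : 'M[R]_n) (c : R)
    (v : 'cV[R]_n) : Prop :=
  [/\ M *m v = c *: v, forall i, 0 < v i 0 & \sum_i v i 0 = 1].

(* The full shift, with the Borel sigma-algebra of the product topology
   (bool carries the discrete topology). A Borel probability measure on the
   closed set hull p below is a Borel probability measure on the full shift
   that gives hull p mass 1. *)
Definition config := g_sigma_algebraType (@open {ptws int -> letter}).

Definition window (x : config) (k : int) (l : nat) : word :=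
  [seq x (k + i%:Z) | i <- iota 0 l].

Definition hull {R : realType} {m : nat} (p : 'I_m.+1 -> R) : set config :=
  [set x | forall k l, legal p (window x k l)].

Definition cylinder {R : realType} {m : nat} (p : 'I_m.+1 -> R) (k : int)
    (v : word) : set config :=
  [set x | hull p x /\ window x k (size v) = v].

Definition left_shift (x : config) : config := fun i => x (i + 1).
Definition left_shift_inv (x : config) : config := fun i => x (i - 1).

Definition left_shift_pow (i : int) : config -> config :=
  match i with
  | Posz n => iter n left_shift
  | Negz n => iter n.+1 left_shift_inv
  end.

(* Main.v *)
Require Import Defs.
From mathcomp Require Import all_boot all_order all_algebra.
From mathcomp Require Import all_classical all_reals all_analysis.
From mathcomp Require Import measurable_realfun ring lra zify.

Set Implicit Arguments.
Unset Strict Implicit.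
Unset Printing Implicit Defensive.

Import Order.TTheory GRing.Theory Num.Theory.
Import numFieldNormedType.Exports.

Local Open Scope classical_set_scope.
Local Open Scope ring_scope.

(** Why the averages converge to the integral.

    The general part concerns a measure-preserving map of a probability space.
    Call a function good when its ergodic averages converge almost everywhere
    to its integral.  The maximal inequality makes the good functions a closed
    subspace of L1 ([birkhoff_closed]).  If [f] is bounded and one of its
    averages [A_M f] is close in L1 to a constant [c], then [f] is close in L1
    to [f - A_M f + c], and the averages of this function converge everywhere
    to [c] because those of [f - A_M f] telescope.  Hence a bounded function is
    good as soon as its averages come arbitrarily close in L1 to constants
    ([birkhoff_bounded]).  By the pi-lambda theorem it is enough to have this
    for the indicators of a generating pi-system ([birkhoff_generated]): here,
    the events that depend on finitely many coordinates.

    What remains is a weak law of large numbers: for a pattern function [g] of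
    [r] letters, the mean of [g] over the [M] first positions of a long window
    must be close, on average over the window, to a constant.  Iterating the
    eigenvector equation [n] times shows that a window of law [phi] is obtained
    from a word [w] of law [phi] by applying [zeta^n] and reading at a position
    inside the image of the first letter, at the cost of the normalisation
    [lambda ^ n] ([iter_transfer], [eigenvector_iter_transfer]).  Once [w] is
    fixed, [zeta^n w] is a concatenation of independent blocks [zeta^n w_j]
    whose lengths are not random, so the sum of [g - c] over [M] positions is a
    sum of independent bounded terms up to boundary effects, and its variance
    is of order [M] ([block_variance]).

    The means of the terms have to be small as well.  Let [L_n(x)] be the
    length of [zeta^n x] and [N_n(x)] the expected sum of [g] over it.  Both
    satisfy [u_{n+1}(a) = m u_n(a) + u_n(b)] and [u_{n+1}(b) = u_n(a)], [L_n]
    exactly and [N_n] up to a bounded error due to the windows that straddle two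
    blocks.  Therefore [D_n = N_n(a) L_n(b) - N_n(b) L_n(a)] satisfies
    [D_{n+1} = - D_n + O(L_n(a))], so [D_n = O(L_n(a))] ([block_mean_det]): with
    [c = N_n(a) / L_n(a)], the mean of [g - c] over a block is bounded
    independently of [n] ([block_mean_bias]), whereas the blocks become longer
    and longer.  Choosing first [n] and then [M] large gives the weak law, with
    no need to identify the constant beforehand ([uniform_deviation]).

    Finally, the averages that start at [s] are the averages that start at [0]
    of the translated point, and translations preserve null sets. *)

(** * Ergodic averages of a measure-preserving map *)

Import HBSimple.

Section ergodic.
Context d (T : measurableType d) (R : realType) (mu : probability T R).
Variable tau : T -> T.
Hypothesis mtau : measurable_fun setT tau.
Hypothesis mutau : forall A, measurable A -> mu (tau @^-1` A) = mu A.
Implicit Types f g : T -> R.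

Definition L1 f := mu.-integrable setT (EFin \o f).

Definition avg f (N : nat) (x : T) : R :=
  N%:R^-1 * \sum_(j < N) f (iter j tau x).

Lemma L1_meas f : L1 f -> measurable_fun setT f.
Proof. by move=> /measurable_int/measurable_EFinP. Qed.

Lemma L1_le f g : measurable_fun setT f -> (forall x, `|f x| <= g x) ->
  L1 g -> L1 f.
Proof.
move=> mf fg ig; apply: le_integrable ig => //; first exact/measurable_EFinP.
by move=> x _; rewrite /= lee_fin (le_trans (fg x))// ler_norm.
Qed.

Lemma L1_cst c : L1 (cst c).
Proof. exact: finite_measure_integrable_cst. Qed.

Lemma L1_D f g : L1 f -> L1 g -> L1 (fun x => f x + g x).
Proof. by move=> f1 g1; exact: (integrableD measurableT f1 g1). Qed.

Lemma L1_Z c f : L1 f -> L1 (fun x => c * f x).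
Proof. by move=> f1; exact: (integrableZl measurableT c f1). Qed.

Lemma L1_B f g : L1 f -> L1 g -> L1 (fun x => f x - g x).
Proof. by move=> f1 g1; exact: (integrableB measurableT f1 g1). Qed.

Lemma L1_norm f : L1 f -> L1 (fun x => `|f x|).
Proof. by move=> f1; exact: (integrable_norm f1). Qed.

Lemma L1_sum I (s : seq I) (h : I -> T -> R) : (forall i, L1 (h i)) ->
  L1 (fun x => \sum_(i <- s) h i x).
Proof.
move=> ih; elim: s => [|i s IHs].
  by under eq_fun do rewrite big_nil; exact: L1_cst.
by under eq_fun do rewrite big_cons; exact: L1_D.
Qed.

Lemma L1_bounded f (B : R) : measurable_fun setT f -> (forall x, `|f x| <= B) -> L1 f.
Proof. by move=> mf fB; apply: (L1_le mf fB); exact: L1_cst. Qed.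

Lemma Rintegral_prob_cst c : \int[mu]_x c = c.
Proof. by rewrite Rintegral_cst// [X in fine X]probability_setT mulr1. Qed.

Lemma integral_tau (h : T -> \bar R) : measurable_fun setT h ->
  (forall x, 0 <= h x)%E -> (\int[mu]_x h (tau x) = \int[mu]_x h x)%E.
Proof.
move=> mh h0.
transitivity (\int[pushforward mu tau]_x h x)%E.
  by rewrite ge0_integral_pushforward.
by apply: eq_measure_integral => A mA _; exact: mutau.
Qed.

Lemma L1_tau f : L1 f -> L1 (f \o tau).
Proof.
move=> /integrableP[mf foo]; apply/integrableP; split.
  exact: (measurableT_comp mf).
by rewrite (@integral_tau (fun x => `|(f x)%:E|%E))//; exact: measurableT_comp.
Qed.

Lemma Rintegral_tau f : L1 f -> \int[mu]_x f (tau x) = \int[mu]_x f x.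
Proof.
move=> f1; congr fine; transitivity (\int[pushforward mu tau]_x (f x)%:E)%E.
  rewrite integral_pushforward//; first exact: measurable_int f1.
  exact: L1_tau f1.
by apply: eq_measure_integral => A mA _; exact: mutau.
Qed.

Lemma L1_iter f n : L1 f -> L1 (fun x => f (iter n tau x)).
Proof.
move=> f1; elim: n => // n IHn.
by under eq_fun do rewrite iterSr; exact: L1_tau IHn.
Qed.

Lemma Rintegral_iter f n : L1 f -> \int[mu]_x f (iter n tau x) = \int[mu]_x f x.
Proof.
move=> f1; elim: n => // n IHn.
under eq_Rintegral do rewrite iterSr.
by rewrite (Rintegral_tau (L1_iter n f1)).
Qed.

Lemma L1_avg f N : L1 f -> L1 (avg f N).
Proof.
move=> f1; apply/L1_Z/L1_sum => i; exact: L1_iter.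
Qed.

Lemma Rintegral_sum I (s : seq I) (h : I -> T -> R) : (forall i, L1 (h i)) ->
  \int[mu]_x (\sum_(i <- s) h i x) = \sum_(i <- s) \int[mu]_x h i x.
Proof.
move=> ih; elim: s => [|i s IHs].
  by under eq_Rintegral do rewrite big_nil; rewrite big_nil Rintegral_prob_cst.
under eq_Rintegral do rewrite big_cons.
by rewrite RintegralD//; [rewrite big_cons IHs|exact: ih|exact: L1_sum].
Qed.

Lemma Rintegral_avg f N : (0 < N)%N -> L1 f -> \int[mu]_x avg f N x = \int[mu]_x f x.
Proof.
move=> N0 f1; rewrite RintegralZl//; last first.
  by apply: L1_sum => i; exact: L1_iter.
rewrite Rintegral_sum; last by move=> i; exact: L1_iter.
under eq_bigr do rewrite Rintegral_iter//.
by rewrite sumr_const card_ord -[X in _ * X]mulr_natl mulKf// pnatr_eq0 -lt0n.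
Qed.

Lemma avgD f g N x : avg (fun x => f x + g x) N x = avg f N x + avg g N x.
Proof. by rewrite /avg big_split mulrDr. Qed.

Lemma avgZ c f N x : avg (fun x => c * f x) N x = c * avg f N x.
Proof. by rewrite /avg -mulr_sumr mulrCA. Qed.

Lemma avgB f g N x : avg (fun x => f x - g x) N x = avg f N x - avg g N x.
Proof. by rewrite /avg sumrB mulrBr. Qed.

Lemma avg_cst c N x : (0 < N)%N -> avg (cst c) N x = c.
Proof.
move=> N0.
by rewrite /avg sumr_const card_ord -[X in _ * X]mulr_natl mulKf// pnatr_eq0 -lt0n.
Qed.

Lemma avg_avg f M N x : avg (avg f M) N x = avg (avg f N) M x.
Proof.
rewrite /avg -!mulr_sumr exchange_big/= mulrCA.
congr (_ * (_ * _)); apply: eq_bigr => i _; apply: eq_bigr => j _.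
by rewrite -!iterD addnC.
Qed.

Lemma avg_norm f N x : `|avg f N x| <= avg (fun x => `|f x|) N x.
Proof. by rewrite /avg normrM normfV normr_nat ler_wpM2l// ler_norm_sum. Qed.

(** The maximum of the sums of [f] over the first [0], ..., [N] points of the
    orbit; this recursive form gives the inequality behind the maximal ergodic
    lemma without any reasoning about maxima over families. *)
Fixpoint maxsum f (N : nat) : T -> R :=
  if N is N'.+1 then fun x => Num.max (f x + maxsum f N' (tau x)) 0 else cst 0.

Lemma L1_maxsum f N : L1 f -> L1 (maxsum f N).
Proof.
move=> f1; elim: N => [|N IHN] /=; first exact: L1_cst.
apply: (integrable_funrpos measurableT).
exact: (L1_D f1 (L1_tau IHN)).
Qed.

Lemma maxsum_ge0 f N x : 0 <= maxsum f N x.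
Proof. by case: N => //= N; rewrite le_max lexx orbT. Qed.

Lemma maxsum_nd f N x : maxsum f N x <= maxsum f N.+1 x.
Proof.
elim: N x => [|N IHN] x; first exact: maxsum_ge0.
rewrite [leLHS]/= ge_max maxsum_ge0 andbT.
by rewrite [leRHS]/= le_max lerD2l IHN.
Qed.

Lemma sum_le_maxsum f N n x : (n <= N)%N ->
  \sum_(j < n) f (iter j tau x) <= maxsum f N x.
Proof.
elim: N n x => [|N IHN] [|n] x; rewrite ?big_ord0 ?maxsum_ge0 ?ltnn// ltnS => nN.
rewrite big_ord_recl /= le_max lerD2l; apply/orP; left.
apply: le_trans (IHN n (tau x) nN).
by under eq_bigr do rewrite -iterS iterSr.
Qed.

(** Garsia's argument: [M - M o tau <= f] where [M = maxsum f N] is positive, and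
    [M - M o tau <= 0] elsewhere, while the integral of [M - M o tau] vanishes. *)
Lemma maximal_ergodic_lemma f N : L1 f ->
  0 <= \int[mu]_(x in [set x | 0 < maxsum f N x]) f x.
Proof.
move=> f1; set E := [set x | _].
have mE : measurable E.
  have := measurable_fun_ltr (@measurable_cst _ _ _ _ setT (0 : R))
             (L1_meas (L1_maxsum N f1)).
  by move=> /(_ measurableT [set true]); rewrite setTI; exact.
case: N @E mE => [|N] E mE.
  rewrite (_ : E = set0) ?Rintegral_set0//.
  by apply/seteqP; split => // x; rewrite /E /= ltxx.
rewrite Rintegral_mkcond.
have M1 := L1_maxsum N.+1 f1.
rewrite -[leLHS](subrr (\int[mu]_x maxsum f N.+1 x)).
rewrite -[X in _ - X](Rintegral_tau M1) -RintegralB//; last exact: (L1_tau M1).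
apply: le_Rintegral => //; first exact: (L1_B M1 (L1_tau M1)).
  have := integrableS measurableT mE (@subsetT _ _) f1.
  by rewrite (integrable_mkcond _ mE) restrict_EFin.
move=> x _; rewrite patchE; case: ifPn => [|].
  rewrite inE /E/= lt_max ltxx orbF => /ltW h.
  by rewrite max_l// lerBlDr lerD2l maxsum_nd.
rewrite notin_setE /E => /negP; rewrite -leNgt => Mle.
by rewrite subr_le0 (le_trans Mle)// maxsum_ge0.
Qed.

(** The maximal ergodic lemma for [`|f| - alpha]: its maximal sum is positive
    wherever some average of [`|f|] exceeds [alpha]. *)
Lemma avg_maximal_inequality f (alpha : R) : L1 f -> 0 < alpha ->
  exists E, [/\ measurable E, (mu E <= (alpha^-1 * \int[mu]_x `|f x|)%:E)%E &
    forall x, ~ E x -> forall N, avg (fun x => `|f x|) N x <= alpha].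
Proof.
move=> f1 a0; pose F x := `|f x| - alpha.
have F1 : L1 F by apply: (L1_B (L1_norm f1)); exact: L1_cst.
pose E N := [set x | 0 < maxsum F N x].
have mE N : measurable (E N).
  have := measurable_fun_ltr (@measurable_cst _ _ _ _ setT (0 : R))
             (L1_meas (L1_maxsum N F1)).
  by move=> /(_ measurableT [set true]); rewrite setTI; exact.
exists (\bigcup_N E N); split.
- exact: bigcupT_measurable.
- have ndE : nondecreasing_seq E.
    apply/nondecreasing_seqP => n; apply/subsetPset => x /= /lt_le_trans; apply.
    exact: maxsum_nd.
  have muE := nondecreasing_cvg_mu (mu := mu) mE (bigcupT_measurable _ mE) ndE.
  rewrite -(cvg_lim _ muE)//; apply: lime_le.
    by apply/cvg_ex; eexists; exact: muE.
  near=> N => /=.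
  have := maximal_ergodic_lemma N F1; rewrite -/(E N).
  have fE : mu.-integrable (E N) (EFin \o (fun x => `|f x|)).
    exact: integrableS (L1_norm f1).
  rewrite RintegralB//; last exact: finite_measure_integrable_cst.
  rewrite Rintegral_cst// subr_ge0 => /le_trans H.
  rewrite -[X in (X <= _)%E]fineK ?fin_num_measure// lee_fin.
  rewrite mulrC ler_pdivlMr// mulrC; apply: H.
  rewrite Rintegral_mkcond; apply: le_Rintegral => //.
  + by have := fE; rewrite (integrable_mkcond _ (mE N)) restrict_EFin.
  + exact: (L1_norm f1).
  + move=> x _; rewrite patchE.
    by case: ifP => _; [exact: lexx|exact: normr_ge0].
- move=> x Ex [|N]; first by rewrite /avg invr0 mul0r ltW.
  rewrite /avg mulrC ler_pdivrMr ?ltr0n//.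
  have := @sum_le_maxsum F N.+1 N.+1 x (leqnn _).
  rewrite big_split/= sumr_const card_ord mulNrn -[alpha *+ _]mulr_natr.
  have /negP : ~ (0 < maxsum F N.+1 x) by move=> h; apply: Ex; exists N.+1.
  rewrite -leNgt => /[swap] /le_trans /[apply]; rewrite subr_le0.
Unshelve. all: by end_near. Qed.

(** The conclusion of the ergodic theorem for [f], with the integral of [f]
    itself as the limit: it holds for every integrable [f] exactly when the map
    is ergodic. *)
Definition birkhoff f := {ae mu, forall x : T,
  (fun N : nat => avg f N x) @ \oo --> \int[mu]_y f y}.

Lemma birkhoff_cst c : birkhoff (cst c).
Proof.
apply: aeW => x; rewrite Rintegral_prob_cst; apply: cvg_near_cst.
by exists 1%N => // N /= N0; rewrite avg_cst.
Qed.

Lemma birkhoffD f g : L1 f -> L1 g -> birkhoff f -> birkhoff g ->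
  birkhoff (fun x => f x + g x).
Proof.
move=> f1 g1; apply: filterS2 => x fx gx.
rewrite RintegralD//; under eq_fun do rewrite avgD; exact: cvgD.
Qed.

Lemma birkhoffZ c f : L1 f -> birkhoff f -> birkhoff (fun x => c * f x).
Proof.
move=> f1; apply: filterS => x fx.
rewrite RintegralZl//; under eq_fun do rewrite avgZ; exact: cvgMr.
Qed.

Lemma birkhoff_sum I (s : seq I) (h : I -> T -> R) : (forall i, L1 (h i)) ->
  (forall i, birkhoff (h i)) -> birkhoff (fun x => \sum_(i <- s) h i x).
Proof.
move=> ih bh; elim: s => [|i s IHs].
  by under eq_fun do rewrite big_nil; exact: birkhoff_cst.
under eq_fun do rewrite big_cons.
by apply: birkhoffD => //; exact: L1_sum.
Qed.

Lemma negligible_small (B : set T) :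
  (forall e : R, 0 < e -> exists E, [/\ measurable E, B `<=` E & (mu E <= e%:E)%E]) ->
  mu.-negligible B.
Proof.
move=> H; have /choice[E HE] j : exists E, [/\ measurable E, B `<=` E
    & (mu E <= (j.+1%:R^-1 : R)%:E)%E] by apply: H; rewrite invr_gt0.
exists (\bigcap_j E j); split.
- by apply: bigcapT_measurable => j; have [] := HE j.
- apply/eqP; rewrite eq_le measure_ge0 andbT; apply/lee_addgt0Pr => e e0.
  rewrite add0e; have [j] := ltr_add_invr e0; rewrite add0r => /ltW je.
  have [mEj _ Ej] := HE j.
  apply: (@le_trans _ _ (mu (E j))); last by rewrite (le_trans Ej)// lee_fin.
  apply: le_measure; rewrite ?inE//; last exact: bigcap_inf.
  by apply: bigcapT_measurable => k; have [] := HE k.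
- by move=> x Bx j _; have [_ + _] := HE j; exact.
Qed.

(** When [g] is good and close to [f], the averages of [f - g] are small at all
    times outside of a set of small measure, by the maximal inequality. *)
Lemma birkhoff_closed f : L1 f ->
  (forall e : R, 0 < e -> exists g,
    [/\ L1 g, birkhoff g & \int[mu]_x `|f x - g x| <= e]) ->
  birkhoff f.
Proof.
move=> f1 H.
have {}H (k : nat) : {ae mu, forall x, \forall N \near \oo,
    `|\int[mu]_y f y - avg f N x| <= k.+1%:R^-1 *+ 3}.
  set e : R := k.+1%:R^-1; have e0 : 0 < e by rewrite invr_gt0.
  apply: negligible_small => eta eta0.
  (* the bound [e] controls the integrals, [e * eta] the exceptional set *)
  have [|g [g1 [Z [mZ Z0 ZP]] fg]] := H (Num.min e (e * eta)).
    by rewrite lt_min e0 mulr_gt0.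
  have [E [mE muE EP]] := avg_maximal_inequality (L1_B f1 g1) e0.
  exists (E `|` Z); split; first exact: measurableU.
    move=> x nx; apply: contrapT => /not_orP[nE nZ]; apply: nx.
    have : (fun N => avg g N x) @ \oo --> \int[mu]_y g y.
      by apply: contrapT => h; apply: nZ; exact: ZP.
    move=> /cvgrPdist_le/(_ _ e0); apply: filterS => N gN.
    have -> : \int[mu]_y f y - avg f N x = (\int[mu]_y f y - \int[mu]_y g y)
        + (\int[mu]_y g y - avg g N x) - (avg f N x - avg g N x) by ring.
    rewrite mulrSr (le_trans (ler_normB _ _))// lerD//.
      rewrite mulr2n (le_trans (ler_normD _ _))// lerD//.
      rewrite -RintegralB// (le_trans (le_normr_Rintegral _ _))//.
        exact: (L1_B f1 g1).
      by rewrite (le_trans fg)// ge_min lexx.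
    by rewrite -avgB (le_trans (avg_norm _ _ _))// EP.
  apply: (le_trans (measureU2 mu mE mZ)).
  rewrite [X in (_ + X)%E](_ : _ = 0%E)// adde0 (le_trans muE)// lee_fin.
  by rewrite ler_pdivrMl// (le_trans fg)// ge_min lexx orbT.
have := ae_foralln H; apply: filterS => x Hx.
apply/cvgrPdist_le => e e0.
have [k] := ltr_add_invr (divr_gt0 e0 (ltr0n R 3)); rewrite add0r => /ltW ke.
apply: filterS (Hx k) => N /le_trans; apply.
by rewrite -[X in X <= _]mulr_natr -ler_pdivlMr.
Qed.

Lemma birkhoff_sum_tau f N x :
  \sum_(i < N) f (iter i tau (tau x)) =
  \sum_(i < N) f (iter i tau x) + (f (iter N tau x) - f x).
Proof.
elim: N => [|N IHN]; first by rewrite !big_ord0 subrr addr0.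
by rewrite !big_ord_recr/= IHN -iterSr/=; ring.
Qed.

(** Moving the starting point by one step changes only the first and the last
    term of the sum. *)
Lemma avg_iter_bounded f (B : R) N j x : (forall y, `|f y| <= B) ->
  `|avg f N (iter j tau x) - avg f N x| <= N%:R^-1 * (B *+ 2 *+ j).
Proof.
move=> fB; elim: j => [|j IHj]; first by rewrite subrr normr0 mulr0n mulr0.
rewrite -(subrK (avg f N (iter j tau x)) (avg _ _ (iter _ _ _))) -addrA.
rewrite (le_trans (ler_normD _ _))// mulrS mulrDr lerD//= {IHj}.
rewrite /avg birkhoff_sum_tau mulrDr addrAC subrr add0r normrM normfV normr_nat.
by rewrite ler_wpM2l// (le_trans (ler_normB _ _))// mulr2n lerD.
Qed.

(** The approximant is [f - avg f M + c]: its averages tend to [c] at every point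
    since those of [f] and of [avg f M] are asymptotically equal, and its
    distance to [f] is the assumed bound. *)
Lemma birkhoff_bounded f (B : R) : measurable_fun setT f -> (forall y, `|f y| <= B) ->
  (forall e : R, 0 < e -> exists M c, (0 < M)%N /\ \int[mu]_x `|avg f M x - c| <= e) ->
  birkhoff f.
Proof.
move=> mf fB H; have f1 := L1_bounded mf fB.
apply: birkhoff_closed => // e /H[M [c [M0 fMc]]].
have fM1 := L1_avg M f1.
have g1 : L1 (fun x => f x - avg f M x + c) by exact: (L1_D (L1_B f1 fM1) (L1_cst c)).
exists (fun x => f x - avg f M x + c); split => //; last first.
  rewrite (le_trans _ fMc)// le_eqVlt; apply/orP; left; apply/eqP.
  by apply: eq_Rintegral => x _; congr `|_|; ring.
apply: aeW => x.
rewrite RintegralD//; [|exact: (L1_B f1 fM1)|exact: L1_cst].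
rewrite RintegralB// Rintegral_avg// subrr add0r Rintegral_prob_cst.
apply/cvgrPdist_le => d0 d00; near=> N.
have N0 : (0 < N)%N by near: N; exists 1%N.
rewrite avgD avgB avg_cst// avg_avg -[avg f N x](avg_cst _ x M0) -avgB.
rewrite opprD addrCA subrr addr0 normrN.
rewrite (le_trans (avg_norm _ _ _))// /avg.
rewrite ler_pdivrMl ?ltr0n//.
rewrite -[leRHS]/(M%:R * d0) mulr_natl.
have -> : d0 *+ M = \sum_(i < M) d0 by rewrite sumr_const card_ord.
apply: ler_sum => i _.
rewrite distrC.
rewrite (le_trans (avg_iter_bounded _ _ _ fB))//.
rewrite ler_pdivrMl ?ltr0n//.
have B0 : 0 <= B by rewrite (le_trans _ (fB x)).
apply: (@le_trans _ _ (B *+ 2 *+ M)).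
  by rewrite ler_wpMn2l// ?mulrn_wge0// ltnW.
rewrite -ler_pdivrMr//; near: N; exact: nbhs_infty_ger.
Unshelve. all: by end_near. Qed.

Lemma Rintegral_indic A : measurable A -> \int[mu]_x \1_A x = fine (mu A).
Proof. by move=> mA; rewrite /Rintegral integral_indic// setIT. Qed.

(** The good events form a Dynkin system, so that they are all the measurable
    sets; then simple functions, which are dense in L1, are good. *)
Lemma birkhoff_generated (G : set (set T)) :
  @measurable _ T = <<s G >> -> setI_closed G ->
  (forall A, G A -> birkhoff \1_A) -> forall f, L1 f -> birkhoff f.
Proof.
move=> GE GI birkG.
have L1_indic A : measurable A -> L1 (\1_A) by move=> mA; exact: integrable_indic.
have birk_indic A : measurable A -> birkhoff \1_A.
  move=> mA; have : <<s G >> A by rewrite -GE.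
  move: A {mA}; apply: dynkin_induction => //.
  - by rewrite indicT; exact: birkhoff_cst.
  - move=> A mA bA.
    rewrite (_ : \1_(~` A) = fun x => 1 + -1 * \1_A x); last first.
      by apply/funext => x; rewrite !indicE in_setC; case: (x \in A) => /=; ring.
    apply: birkhoffD; [exact: L1_cst|exact: (L1_Z _ (L1_indic _ mA))|
      exact: birkhoff_cst|exact: (birkhoffZ _ (L1_indic _ mA) bA)].
  - move=> F mF tF bF; have mU := bigcupT_measurable F mF.
    apply: birkhoff_closed; first exact: L1_indic.
    move=> e e0.
    have /fine_cvgP[_ /cvgrPdist_le/(_ _ e0)[n _ /(_ n (leqnn n))]] :
        (fun n => \sum_(0 <= i < n) mu (F i))%E @ \oo -->
        (fine (mu (\bigcup_i F i)))%:E.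
      by rewrite fineK ?fin_num_measure//; exact: measure_semi_sigma_additive.
    move=> nP; exists (fun x => \sum_(i < n) \1_(F i) x); split.
    + by apply: L1_sum => i; exact: L1_indic.
    + by apply: birkhoff_sum => i //; exact: L1_indic.
    + have sumle x : \sum_(i < n) \1_(F i) x <= \1_(\bigcup_i F i) x :> R.
        have [[i Fix]|nF] := pselect (exists i : 'I_n, F i x); last first.
          rewrite big1 ?indicE ?ler0n// => i _; rewrite indicE memNset// => Fix.
          by apply: nF; exists i.
        rewrite (bigD1 i)//= big1 ?addr0 => [|j ji].
          by rewrite !indicE !mem_set//; exists i.
        rewrite indicE memNset// => Fjx; move/eqP: ji; apply; apply/val_inj => /=.
        by apply: tF => //; exists x.
      under eq_Rintegral do rewrite ger0_norm ?subr_ge0//.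
      have F1 (i : 'I_n) : L1 (\1_(F i)) by exact: L1_indic.
      rewrite RintegralB//; [|exact: L1_indic|exact: L1_sum].
      rewrite Rintegral_sum// Rintegral_indic//.
      under eq_bigr do rewrite Rintegral_indic//.
      apply: le_trans nP; rewrite (le_trans _ (ler_norm _))//= lerB// big_mkord.
      under [X in fine X]eq_bigr do rewrite -[mu (F _)]fineK ?fin_num_measure//.
      by rewrite sumEFin.
move=> f f1; apply: birkhoff_closed => // e e0.
have [g [g1 _ /fine_cvgP[_ /cvgrPdist_le/(_ _ e0)[n _ /(_ n (leqnn n))]]]] :=
  approximation_sfun_integrable measurableT f1.
rewrite sub0r normrN => gn; exists (g n); split; [exact: g1|..].
  have /funext -> := fimfunEord (g n); set s := finmap.enum_fset _.
  apply: birkhoff_sum => i.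
  - by apply/L1_Z/L1_indic.
  - by apply: birkhoffZ; [exact: L1_indic|exact: birk_indic].
by rewrite (le_trans _ gn)// (le_trans _ (ler_norm _)).
Qed.
End ergodic.

(** * Expectations of finitely supported laws *)

Section laws.
Context {R : realType}.

Lemma expect_lret T (x : T) (g : T -> R) : expect (lret x) g = g x.
Proof. by rewrite /expect big_seq1 mul1r. Qed.

Lemma expect_lmap T U (h : T -> U) (X : law R T) (g : U -> R) :
  expect (lmap h X) g = expect X (g \o h).
Proof. by rewrite /expect big_map. Qed.

Lemma expect_lbind T U (X : law R T) (F : T -> law R U) (g : U -> R) :
  expect (lbind X F) g = expect X (fun x => expect (F x) g).
Proof.
rewrite /expect /lbind big_flatten/= big_map; apply: eq_bigr => qx _.
by rewrite big_map/= mulr_sumr; apply: eq_bigr => ry _; rewrite mulrA.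
Qed.

Lemma eq_expect T (X : law R T) (g h : T -> R) : g =1 h -> expect X g = expect X h.
Proof. by move=> gh; apply: eq_bigr => qx _; rewrite gh. Qed.

Lemma expectD T (X : law R T) (g h : T -> R) :
  expect X (fun x => g x + h x) = expect X g + expect X h.
Proof. by rewrite /expect -big_split; apply: eq_bigr => qx _; rewrite mulrDr. Qed.

Lemma expectZ T (X : law R T) c (g : T -> R) :
  expect X (fun x => c * g x) = c * expect X g.
Proof. by rewrite /expect mulr_sumr; apply: eq_bigr => qx _; rewrite mulrCA. Qed.

Lemma expectB T (X : law R T) (g h : T -> R) :
  expect X (fun x => g x - h x) = expect X g - expect X h.
Proof. by rewrite /expect -sumrB; apply: eq_bigr => qx _; rewrite mulrBr. Qed.

Lemma expect_sum T I (s : seq I) (P : pred I) (X : law R T) (g : I -> T -> R) :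
  expect X (fun x => \sum_(i <- s | P i) g i x) = \sum_(i <- s | P i) expect X (g i).
Proof.
by rewrite /expect exchange_big/=; apply: eq_bigr => qx _; rewrite mulr_sumr.
Qed.

Lemma expect_exchange T U (X : law R T) (Y : law R U) (g : T -> U -> R) :
  expect X (fun x => expect Y (g x)) = expect Y (fun y => expect X (g^~ y)).
Proof.
rewrite /expect; under eq_bigr do rewrite mulr_sumr.
rewrite exchange_big/=; apply: eq_bigr => ry _; rewrite mulr_sumr.
by apply: eq_bigr => qx _; rewrite mulrCA.
Qed.

(** [X] is a probability distribution carried by [P]; the condition bears on all
    listed outcomes, also those of weight zero. *)
Definition law_on T (X : law R T) (P : pred T) : Prop :=
  all (fun qx => (0 <= qx.1) && P qx.2) X /\ \sum_(qx <- X) qx.1 = 1.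

Lemma expect_cst T (X : law R T) P c : law_on X P -> expect X (fun=> c) = c.
Proof. by case=> _ X1; rewrite /expect -mulr_suml X1 mul1r. Qed.

Lemma le_expect T (X : law R T) P (g h : T -> R) : law_on X P ->
  (forall x, P x -> g x <= h x) -> expect X g <= expect X h.
Proof.
case=> XP _ gh; rewrite /expect; elim: X XP => [|qx X IHX]; first by rewrite !big_nil.
move=> /= /andP[/andP[q0 Px] XP]; rewrite !big_cons lerD ?IHX//.
by rewrite ler_wpM2l// gh.
Qed.

Lemma eq_expect_on T (X : law R T) P (g h : T -> R) : law_on X P ->
  (forall x, P x -> g x = h x) -> expect X g = expect X h.
Proof.
move=> XP gh; apply/eqP; rewrite eq_le !(le_expect XP)// => x Px; by rewrite gh.
Qed.

Lemma expect_le_cst T (X : law R T) P (g : T -> R) c : law_on X P ->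
  (forall x, P x -> g x <= c) -> expect X g <= c.
Proof. by move=> XP gc; rewrite -[leRHS](expect_cst c XP); exact: le_expect XP gc. Qed.

Lemma norm_expect T (X : law R T) P (g : T -> R) : law_on X P ->
  `|expect X g| <= expect X (fun x => `|g x|).
Proof.
move=> XP; rewrite ler_norml -mulN1r -expectZ !(le_expect XP)// => x _.
  exact: ler_norm.
by rewrite mulN1r lerNl -normrN ler_norm.
Qed.

Lemma law_on_lret T (x : T) (P : pred T) : P x -> law_on (lret x) P.
Proof. by move=> Px; split; rewrite ?big_seq1//= ler01 Px. Qed.

Lemma law_on_sub T (X : law R T) (P Q : pred T) :
  (forall x, P x -> Q x) -> law_on X P -> law_on X Q.
Proof.
move=> PQ [XP X1]; split => //; apply: sub_all XP => qx /andP[-> /PQ]; exact.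
Qed.

Lemma law_on_lmap T U (h : T -> U) (X : law R T) (P : pred T) (Q : pred U) :
  (forall x, P x -> Q (h x)) -> law_on X P -> law_on (lmap h X) Q.
Proof.
move=> PQ [XP X1]; split; last by rewrite big_map.
by rewrite all_map; apply: sub_all XP => qx /= /andP[-> /PQ].
Qed.

Lemma law_on_lbind T U (X : law R T) (F : T -> law R U) (P : pred T) (Q : pred U) :
  law_on X P -> (forall x, P x -> law_on (F x) Q) -> law_on (lbind X F) Q.
Proof.
move=> XP FQ; split; last first.
  transitivity (expect (lbind X F) (fun=> 1)).
    by apply: eq_bigr => qx _; rewrite mulr1.
  rewrite expect_lbind (eq_expect_on XP (h := fun=> 1)) ?(expect_cst _ XP)// => x.
  by move=> /FQ/expect_cst.
case: XP => XP _; rewrite /lbind; elim: X XP => //= -[q x] X IHX.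
move=> /andP[/andP[/= q0 Px] XP]; rewrite all_cat IHX// andbT all_map.
have [+ _] := FQ _ Px; apply: sub_all => ry /= /andP[r0 ->].
by rewrite mulr_ge0.
Qed.

End laws.

Lemma sum_word (V : nmodType) (h : bool -> V) (w : seq bool) :
  \sum_(x <- w) h x = h true *+ count_mem true w + h false *+ count_mem false w.
Proof.
elim: w => [|[] w IHw]; rewrite ?big_nil ?big_cons/= ?addr0//= IHw.
  by rewrite add0n add1n mulrS addrA.
by rewrite add0n add1n mulrS addrCA.
Qed.

(** * Iterated images of words *)

Section noble.
Context {R : realType} {m : nat} (p : 'I_m.+1 -> R).
Hypothesis p_ge0 : forall i, 0 <= p i.
Hypothesis p_sum1 : \sum_i p i = 1.

Notation zeta := (zeta p).
Notation zeta_iter := (zeta_iter p).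

Lemma expect_zeta_cons x w G : expect (zeta (x :: w)) G =
  expect (zeta_letter p x) (fun u => expect (zeta w) (fun v => G (u ++ v))).
Proof. by rewrite expect_lbind; apply: eq_expect => u; rewrite expect_lmap. Qed.

Lemma expect_zeta_cat w1 w2 G : expect (zeta (w1 ++ w2)) G =
  expect (zeta w1) (fun u => expect (zeta w2) (fun v => G (u ++ v))).
Proof.
elim: w1 G => [|x w1 IH] G; first by rewrite expect_lret.
rewrite cat_cons !expect_zeta_cons; apply: eq_expect => u.
rewrite IH; apply: eq_expect => v; apply: eq_expect => v'.
by rewrite catA.
Qed.

(** [zeta_iter] applies the last substitution outermost; the inductions below
    need to peel off the first one. *)
Lemma expect_zeta_iterS n w G :
  expect (zeta_iter n.+1 w) G = expect (zeta w) (fun v => expect (zeta_iter n v) G).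
Proof.
elim: n G => [|n IH] G.
  rewrite /zeta_iter/= expect_lbind expect_lret; apply: eq_expect => v.
  by rewrite expect_lret.
rewrite {1}/zeta_iter iterS expect_lbind -/(zeta_iter _ _) IH.
by apply: eq_expect => v; rewrite /zeta_iter iterS expect_lbind.
Qed.

(** The image of a concatenation is the concatenation of independent images. *)
Lemma expect_zeta_iter_cat n w1 w2 G : expect (zeta_iter n (w1 ++ w2)) G =
  expect (zeta_iter n w1) (fun u => expect (zeta_iter n w2) (fun v => G (u ++ v))).
Proof.
elim: n w1 w2 G => [|n IH] w1 w2 G; first by rewrite !expect_lret.
rewrite !expect_zeta_iterS expect_zeta_cat; apply: eq_expect => u.
under eq_expect do rewrite IH.
under [RHS]eq_expect do rewrite expect_zeta_iterS.
by rewrite expect_exchange.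
Qed.

Definition letter_counts (x : bool) (w : seq bool) :=
  (count_mem true w == if x then m else 1%N) && (count_mem false w == x :> nat).

Lemma law_on_zeta_letter x : law_on (zeta_letter p x) (letter_counts x).
Proof.
rewrite /zeta_letter; case: x => /=; last exact: law_on_lret.
split; last by rewrite big_image.
rewrite all_map; apply/allP => i _ /=; rewrite p_ge0 /letter_counts/=.
rewrite !count_cat/= !count_nseq/= !mul1n !mul0n !addn0 add0n subnKC ?eqxx//.
by rewrite -ltnS.
Qed.

(** The length of all realisations of [zeta^n x]. *)
Fixpoint letter_len (n : nat) (x : bool) : nat :=
  if n is n'.+1 then
    if x then (m * letter_len n' true + letter_len n' false)%N else letter_len n' true
  else 1%N.

Definition image_len n (w : seq bool) : nat := (\sum_(x <- w) letter_len n x)%N.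

Lemma image_len_cons n x w : image_len n (x :: w) = (letter_len n x + image_len n w)%N.
Proof. exact: big_cons. Qed.

Lemma image_len_cat n w1 w2 : image_len n (w1 ++ w2) = (image_len n w1 + image_len n w2)%N.
Proof. exact: big_cat. Qed.

Lemma image_len0 w : image_len 0 w = size w.
Proof. by rewrite /image_len big_const_seq count_predT iter_addn_0 mul1n. Qed.

Lemma image_len_letter n x V : letter_counts x V -> image_len n V = letter_len n.+1 x.
Proof.
have mulrn_nat (k i : nat) : (i *+ k = i * k)%N.
  by elim: k => [|k IHk]; rewrite ?muln0// mulrS IHk mulnS.
move=> /andP[/eqP Ca /eqP Cb].
rewrite /image_len [LHS](sum_word (letter_len n)) Ca Cb !mulrn_nat.
by rewrite -[LHS]/(_ + _)%N; case: x {Ca Cb} => /=; lia.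
Qed.

Lemma law_on_zeta n w : law_on (zeta w) (fun V => image_len n V == image_len n.+1 w).
Proof.
elim: w => [|x w IHw]; first by apply: law_on_lret; rewrite /image_len !big_nil.
rewrite image_len_cons; apply: law_on_lbind (law_on_zeta_letter x) _ => u ux.
apply: law_on_lmap IHw => v /eqP vw.
by rewrite image_len_cat vw (image_len_letter _ ux).
Qed.

Lemma law_on_zeta_iter n w : law_on (zeta_iter n w) (fun U => size U == image_len n w).
Proof.
suff H k : law_on (zeta_iter n w) (fun U => image_len k U == image_len (k + n) w).
  by have := H 0%N; apply: law_on_sub => U; rewrite image_len0.
elim: n k => [|n IHn] k; first by apply: law_on_lret; rewrite addn0.
apply: law_on_lbind (IHn k.+1) _ => U /eqP Uw.
by rewrite addnS -addSn -Uw; exact: law_on_zeta.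
Qed.

(** The action on functions that is dual to the substitution matrix of the words
    of length [l]: the column [w] of the matrix, paired with [G]. *)
Definition transfer l (G : seq bool -> R) (w : seq bool) : R :=
  expect (zeta w) (fun V =>
    \sum_(k < zeta_len (m := m) (head a_ w)) G (take l (drop k V))).

(** The expected sum of [H] over the suffixes of [zeta^n V] that start inside the
    image of the first letter of [V]. *)
Definition head_block_sum n (H : seq bool -> R) (V : seq bool) : R :=
  expect (zeta_iter n V) (fun U => \sum_(k < letter_len n (head a_ V)) H (drop k U)).

(** A position in the image of the first [q] letters lies in the image of one of
    them, and the suffix that starts there depends only on the images of this
    letter and of those after it. *)
Lemma expect_sum_positions n H q V : (q <= size V)%N ->
  expect (zeta_iter n V) (fun U => \sum_(k < image_len n (take q V)) H (drop k U)) =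
  \sum_(j < q) head_block_sum n H (drop j V).
Proof.
elim: V q => [|x V IHV] [|q] // => [_|_|/= /[!ltnS] qV].
1,2: rewrite big_ord0; under eq_expect do rewrite take0 /image_len big_nil big_ord0;
     exact: (expect_cst _ (law_on_zeta_iter _ _)).
rewrite big_ord_recl/= -IHV// {1}/head_block_sum/=.
have E G : expect (zeta_iter n (x :: V)) G = expect (zeta_iter n [:: x])
    (fun u => expect (zeta_iter n V) (fun v => G (u ++ v))).
  by rewrite -cat1s expect_zeta_iter_cat.
rewrite !E -[X in _ = _ + X](expect_cst _ (law_on_zeta_iter n [:: x])) -expectD.
apply: (eq_expect_on (law_on_zeta_iter n [:: x])) => u.
rewrite /image_len big_seq1 => /eqP su; rewrite -expectD; apply: eq_expect => v.
rewrite big_cons big_split_ord/=; congr (_ + _); apply: eq_bigr => i _.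
by rewrite -su drop_cat ltnNge leq_addr/= addKn.
Qed.

Lemma letter_len_gt0 n x : (0 < letter_len n x)%N.
Proof. by elim: n x => // n IHn []/=; rewrite ?addn_gt0 IHn ?orbT. Qed.

Lemma size_le_image_len n w : (size w <= image_len n w)%N.
Proof.
elim: w => [|x w IHw]; first by rewrite /image_len big_nil.
by rewrite image_len_cons/= -add1n leq_add ?letter_len_gt0.
Qed.

(** No letter has an empty image, so a window of length [l] that starts in the
    image of the first letter ends before the image of the letter of index
    [l]. *)
Lemma head_block_sum_take n l G V : (0 < l)%N ->
  head_block_sum n (fun u => G (take l u)) (take l V) =
  head_block_sum n (fun u => G (take l u)) V.
Proof.
case: l => // l _; have [Vl|lV] := leqP (size V) l.+1; first by rewrite take_oversize.
rewrite -[in RHS](cat_take_drop l.+1 V) /head_block_sum expect_zeta_iter_cat.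
apply: (eq_expect_on (law_on_zeta_iter n _)) => u /eqP su.
rewrite -[LHS](expect_cst _ (law_on_zeta_iter n (drop l.+1 V))).
apply: eq_expect => v; case: V lV su => // x V /=; rewrite ltnS => lV.
rewrite image_len_cons => su; apply: eq_bigr => k _.
have := size_le_image_len n (take l V); rewrite size_takel ?(ltnW lV)// => lw.
have kL := ltn_ord k.
rewrite drop_cat; case: ltnP => ku; last by lia.
rewrite take_cat size_drop; case: ltnP => // ul.
have -> : l.+1 = (size u - k)%N by lia.
by rewrite subnn take0 cats0 take_oversize// size_drop.
Qed.

Lemma zeta_lenE x : zeta_len (m := m) x = letter_len 1 x.
Proof. by case: x; rewrite /zeta_len//= muln1 addn1. Qed.

(** The induced substitution on words of length [l] iterates as [zeta] does: its
    [n]-th power lists the windows of [zeta^n w] that start in the image of the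
    first letter. *)
Lemma iter_transfer n l G w : (0 < size w <= l)%N ->
  iter n (transfer l) G w = head_block_sum n (fun u => G (take l u)) w.
Proof.
elim: n w => [|n IHn] [//|x w] wl.
  by rewrite /head_block_sum/= expect_lret/= big_ord1 drop0 take_oversize.
have l0 : (0 < l)%N by case: l wl {IHn}.
rewrite iterS /transfer /head_block_sum expect_zeta_iterS !expect_zeta_cons.
apply: (eq_expect_on (law_on_zeta_letter x)) => u ux; apply: eq_expect => v.
rewrite -[head a_ (x :: w)]/x.
have su : size u = zeta_len (m := m) x.
  by rewrite zeta_lenE -(image_len_letter 0 ux) image_len0.
rewrite -su -(image_len_letter n ux) -[in image_len n _](take_size_cat v (erefl (size u))).
rewrite (expect_sum_positions n (fun u => G (take l u))) ?size_cat ?leq_addr//.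
apply: eq_bigr => k _; rewrite IHn ?head_block_sum_take//.
by rewrite size_take_min size_drop size_cat; have := ltn_ord k; lia.
Qed.

Lemma transfer_ge0 l G w : (forall u, 0 <= G u) -> 0 <= transfer l G w.
Proof.
move=> G0; rewrite -[leLHS](expect_cst 0 (law_on_zeta 0 w)).
apply: (le_expect (law_on_zeta 0 w)) => V _.
by apply: sumr_ge0 => k _; exact: G0.
Qed.

(** The left-hand side only sees those windows of the images that are legal
    words, whereas [transfer] sums the nonnegative [G] over all of them. *)
Lemma eigenvector_transfer l (phi : 'cV[R]_#|legal_words p l|) (c : R) G :
  subst_mx p l *m phi = c *: phi -> (forall i, 0 <= phi i 0) ->
  (forall u, 0 <= G u) ->
  c * (\sum_i phi i 0 * G (legal_word i)) <= \sum_i phi i 0 * transfer l G (legal_word i).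
Proof.
move=> Mphi phi0 G0.
have -> : c * (\sum_i phi i 0 * G (legal_word i)) =
    \sum_j phi j 0 * \sum_i subst_mx p l i j * G (legal_word i).
  transitivity (\sum_i (subst_mx p l *m phi) i 0 * G (legal_word i)).
    by rewrite Mphi mulr_sumr; apply: eq_bigr => i _; rewrite mxE mulrA.
  under eq_bigr do rewrite mxE mulr_suml.
  rewrite exchange_big/=; apply: eq_bigr => j _; rewrite mulr_sumr.
  by apply: eq_bigr => i _; rewrite mulrCA mulrA.
apply: ler_sum => j _; apply: ler_wpM2l => //.
under eq_bigr do rewrite mxE expect_lmap mulrC -expectZ.
rewrite -expect_sum; apply: (le_expect (law_on_zeta 0 _)) => V _ /=.
rewrite -(big_mkord xpredT (fun k => G (take l (drop k V)))) /index_iota subn0.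
set s := iota _ _; elim: s => [|k s IHs].
  by rewrite big_nil big1// => i _; rewrite mulr0.
rewrite big_cons; under eq_bigr do rewrite /= natrD mulrDr.
rewrite big_split/= lerD//.
set u := take _ _.
have [[i ui]|nu] := pselect (exists i : 'I_#|legal_words p l|, u = legal_word i).
  rewrite (bigD1 i)//= big1 ?ui ?eqxx ?mulr1 ?addr0// => j' /negP ij.
  case: eqP => [e|]; last by rewrite mulr0.
  by case: ij; apply/eqP/enum_val_inj/val_inj; rewrite /= -[LHS]e.
rewrite big1// => i _; case: eqP => [e|]; last by rewrite mulr0.
by case: nu; exists i.
Qed.

Lemma eigenvector_iter_transfer n l (phi : 'cV[R]_#|legal_words p l|) (c : R) G :
  0 <= c -> subst_mx p l *m phi = c *: phi -> (forall i, 0 <= phi i 0) ->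
  (forall u, 0 <= G u) ->
  c ^+ n * (\sum_i phi i 0 * G (legal_word i)) <=
  \sum_i phi i 0 * iter n (transfer l) G (legal_word i).
Proof.
move=> c0 Mphi phi0 G0; elim: n => [|n IHn]; first by rewrite expr0 mul1r.
rewrite exprS -mulrA (le_trans (ler_wpM2l c0 IHn))//.
apply: eigenvector_transfer => //; elim: n {IHn} => // n IHn u; exact: transfer_ge0.
Qed.

(** * Sums over windows and independent blocks *)

Section windows.
Variables (r : nat) (f : seq bool -> R).
Hypothesis f_osc : forall u v, `|f u - f v| <= 1.

Definition window_sum q (U : seq bool) : R := \sum_(i < q) f (take r (drop i U)).

Lemma window_sumD q1 q2 U :
  window_sum (q1 + q2) U = window_sum q1 U + window_sum q2 (drop q1 U).
Proof.
rewrite /window_sum big_split_ord/=; congr (_ + _); apply: eq_bigr => i _.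
by rewrite drop_drop addnC.
Qed.

(** Appending [V] to [U] only alters the windows that start at one of the last
    [r] positions of [U]. *)
Lemma window_sum_cat U V :
  `|window_sum (size U) (U ++ V) - window_sum (size U) U| <= r%:R.
Proof.
suff : `|window_sum (size U) (U ++ V) - window_sum (size U) U| <= (minn r (size U))%:R.
  by move=> /le_trans; apply; rewrite ler_nat geq_minl.
elim: U => [|x U IHU]; first by rewrite /window_sum !big_ord0 subrr normr0.
rewrite /= -add1n !window_sumD /= !drop0.
rewrite /window_sum !big_ord1 !drop0 -!/(window_sum _ _) opprD addrACA.
rewrite (le_trans (ler_normD _ _))//.
have [rU|Ur] := leqP r (size U).+1.
  have -> : take r (x :: (U ++ V)) = take r (x :: U).
    rewrite -cat_cons take_cat /= ltn_neqAle rU andbT; case: eqP => //= ->.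
    by rewrite subnn take0 cats0 take_oversize.
  rewrite subrr normr0 add0r.
  by rewrite (le_trans IHU)// ler_nat geq_minl.
by rewrite -add1n natrD lerD ?f_osc// (le_trans IHU)// ler_nat geq_minr.
Qed.

(** A word [U] drawn from [zeta^n w] is cut into the images of the letters of [w],
    and each of them is summed on its own: windows are truncated at the end of
    their block, which makes the terms independent. *)
Fixpoint sum_in_blocks n (w U : seq bool) : R :=
  if w is x :: w' then
    window_sum (letter_len n x) (take (letter_len n x) U) +
      sum_in_blocks n w' (drop (letter_len n x) U)
  else 0.

Lemma window_sum_blocks n w U : size U = image_len n w ->
  `|window_sum (image_len n w) U - sum_in_blocks n w U| <= (r * size w)%:R.
Proof.
elim: w U => [|x w IHw] U.
  by rewrite /image_len big_nil /window_sum big_ord0 subrr normr0.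
rewrite image_len_cons => sU /=; set L := letter_len n x; rewrite window_sumD opprD addrACA.
have sL : size (take L U) = L by rewrite size_take_min sU; apply/minn_idPl/leq_addr.
rewrite (le_trans (ler_normD _ _))// mulnS natrD lerD//.
  by have := window_sum_cat (take L U) (drop L U); rewrite cat_take_drop sL.
by rewrite IHw// size_drop sU addKn.
Qed.

Definition block_mean n x := expect (zeta_iter n [:: x]) (window_sum (letter_len n x)).

Lemma sum_in_blocks_cons n x w u v : size u = letter_len n x ->
  sum_in_blocks n (x :: w) (u ++ v) = window_sum (letter_len n x) u + sum_in_blocks n w v.
Proof. by move=> su; rewrite /= -su take_size_cat// drop_size_cat. Qed.

Lemma expect_zeta_iter_cons n x w G : expect (zeta_iter n (x :: w)) G =
  expect (zeta_iter n [:: x]) (fun u => expect (zeta_iter n w) (fun v => G (u ++ v))).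
Proof. by rewrite -cat1s expect_zeta_iter_cat. Qed.

Lemma law_on_zeta_iter1 n x :
  law_on (zeta_iter n [:: x]) (fun U => size U == letter_len n x).
Proof. by have := law_on_zeta_iter n [:: x]; rewrite /image_len big_seq1. Qed.

Lemma expect_sum_in_blocks n w :
  expect (zeta_iter n w) (sum_in_blocks n w) = \sum_(x <- w) block_mean n x.
Proof.
elim: w => [|x w IHw].
  by rewrite big_nil; exact: (expect_cst _ (law_on_zeta_iter n [::])).
rewrite big_cons expect_zeta_iter_cons -IHw.
rewrite -[X in _ = _ + X](expect_cst _ (law_on_zeta_iter1 n x)) -expectD.
apply: (eq_expect_on (law_on_zeta_iter1 n x)) => u /eqP su.
under eq_expect do rewrite sum_in_blocks_cons//.
by rewrite expectD (expect_cst _ (law_on_zeta_iter n w)).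
Qed.

Hypothesis f_le1 : forall u, `|f u| <= 1.

Lemma norm_window_sum q U : `|window_sum q U| <= q%:R.
Proof.
rewrite (le_trans (ler_norm_sum _ _ _))// -[X in _ <= X%:R]card_ord -sumr_const.
by apply: ler_sum => i _.
Qed.

(** The variance of a sum of independent terms is the sum of their variances:
    the cross term vanishes because the tail of the sum is centered. *)
Lemma block_variance n w (L : R) : (forall x, (letter_len n x)%:R <= L) ->
  expect (zeta_iter n w)
    (fun U => (sum_in_blocks n w U - \sum_(x <- w) block_mean n x) ^+ 2)
  <= (size w)%:R * (L *+ 2) ^+ 2.
Proof.
move=> lenL; elim: w => [|x w IHw].
  rewrite mul0r; apply: (expect_le_cst (law_on_zeta_iter n [::])) => U _ /=.
  by rewrite big_nil subrr expr0n.
rewrite big_cons expect_zeta_iter_cons -[size (x :: w)]/(size w).+1.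
rewrite -natr1 mulrDl mul1r [leRHS]addrC.
apply: (expect_le_cst (law_on_zeta_iter1 n x)) => u /eqP su.
set a := block_mean n x; set b := \sum_(_ <- _) _.
rewrite [leLHS](_ : _ = expect (zeta_iter n w) (fun v =>
    (window_sum (letter_len n x) u - a) ^+ 2 +
    (2 * (window_sum (letter_len n x) u - a) * (sum_in_blocks n w v - b) +
     (sum_in_blocks n w v - b) ^+ 2))); last first.
  by apply: eq_expect => v; rewrite sum_in_blocks_cons//; ring.
rewrite !expectD expectZ expectB expect_sum_in_blocks -/b.
rewrite !(expect_cst _ (law_on_zeta_iter n w)) subrr mulr0 add0r lerD//.
rewrite -[leLHS]real_normK ?num_real// lerXn2r ?nnegrE//.
  by rewrite mulrn_wge0// (le_trans _ (lenL x)).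
rewrite (le_trans (ler_normB _ _))// mulr2n lerD//.
  exact: le_trans (norm_window_sum _ _) (lenL x).
rewrite (le_trans (norm_expect _ (law_on_zeta_iter1 n x)))//.
apply: (expect_le_cst (law_on_zeta_iter1 n x)) => U _.
exact: le_trans (norm_window_sum _ _) (lenL x).
Qed.

(** The first moment is controlled by the second through
    [t <= (eta + t ^+ 2 / eta) / 2]. *)
Lemma expect_norm_sum_in_blocks n w (L C eta : R) :
  (forall x, (letter_len n x)%:R <= L) -> (forall x, `|block_mean n x| <= C) ->
  0 < eta ->
  expect (zeta_iter n w) (fun U => `|sum_in_blocks n w U|) <=
  (size w)%:R * C + (eta + (size w)%:R * (L *+ 2) ^+ 2 / eta) / 2.
Proof.
move=> lenL meanC eta0; set b := \sum_(x <- w) block_mean n x.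
have bC : `|b| <= (size w)%:R * C.
  rewrite (le_trans (ler_norm_sum _ _ _))// /b; elim: w {b} => [|x w IHw].
    by rewrite big_nil mul0r.
  by rewrite big_cons /= -natr1 mulrDl mul1r [leRHS]addrC lerD.
apply: le_trans (le_expect (h := fun U =>
    `|b| + (eta / 2 + (2 * eta)^-1 * (sum_in_blocks n w U - b) ^+ 2))
    (law_on_zeta_iter n w) _) _ => [U _|].
  set z := sum_in_blocks n w U; rewrite -[z in leLHS](subrK b) addrC.
  rewrite (le_trans (ler_normD _ _))// lerD2l -[(z - b) ^+ 2]real_normK ?num_real//.
  set t := `|z - b|; rewrite -subr_ge0.
  rewrite (_ : _ - _ = (2 * eta)^-1 * (eta - t) ^+ 2); last by field; rewrite gt_eqF.
  by rewrite mulr_ge0 ?sqr_ge0// invr_ge0 mulr_ge0// ltW.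
rewrite !expectD (expectZ _ (2 * eta)^-1).
rewrite !(expect_cst _ (law_on_zeta_iter n w)) lerD//.
rewrite [leRHS]mulrDl lerD2l [leLHS]mulrC -[leRHS]mulrA -invfM (mulrC eta).
rewrite ler_wpM2r//.
  by rewrite invr_ge0 mulr_ge0// ltW.
exact: block_variance.
Qed.

(** The two letters have images of different lengths, so the number [J] of blocks
    that fill the first [M] positions depends on [w]. *)
Lemma cut_at_block n w M L :
  (forall x, (letter_len n x <= L)%N) -> (M <= image_len n w)%N ->
  exists J, [/\ (J <= size w)%N, (image_len n (take J w) <= M)%N &
    (M <= image_len n (take J w) + L)%N].
Proof.
move=> lenL; elim: w M => [|x w IHw] M.
  rewrite {1}/image_len big_nil leqn0 => /eqP ->.
  by exists 0%N; rewrite /= /image_len !big_nil.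
rewrite image_len_cons; have [Mx _|xM Mw] := leqP M (letter_len n x).
  by exists 0%N; rewrite /image_len /= big_nil add0n (leq_trans Mx).
have [|J [Jw J1 J2]] := IHw (M - letter_len n x)%N; first lia.
by exists J.+1; rewrite /= image_len_cons; split=> //; lia.
Qed.

(** [J] is the number of blocks that fill the window.  The summand [3 * L] pays
    for the offset [k] and for the incomplete blocks at both ends,
    [r + J * r] for the windows which straddle two blocks, [J * C] for the
    means of the blocks, and the last one for their fluctuations. *)
Lemma expect_norm_window_sum n w M k L Lmin (C eta : R) :
  (forall x, (Lmin <= letter_len n x <= L)%N) -> (forall x, `|block_mean n x| <= C) ->
  0 < eta -> (M <= size w)%N -> (k <= L)%N ->
  exists J, (J * Lmin <= M)%N /\
  expect (zeta_iter n w) (fun U => `|window_sum M (drop k U)|) <=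
  (3 * L + r)%:R + J%:R * (r%:R + C) + (eta + J%:R * (L%:R *+ 2) ^+ 2 / eta) / 2.
Proof.
move=> lenL meanC eta0 Mw kL.
have lenL1 x : (letter_len n x <= L)%N by have /andP[] := lenL x.
have [J [Jw JM MJ]] := cut_at_block lenL1 (leq_trans Mw (size_le_image_len n w)).
exists J; split.
  apply: leq_trans JM; rewrite -[in leqLHS](size_takel Jw).
  elim: (take J w) => [|x w' IH] //=; rewrite image_len_cons mulSn leq_add//.
  by have /andP[] := lenL x.
set A := image_len n (take J w) in JM MJ.
have near U : `|window_sum M (drop k U)| <= (3 * L)%:R + `|window_sum A U|.
  have E : window_sum k U + window_sum M (drop k U) =
      window_sum A U + window_sum (k + M - A) (drop A U).
    by rewrite -!window_sumD; congr window_sum; lia.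
  have -> : window_sum M (drop k U) =
      window_sum A U + window_sum (k + M - A) (drop A U) - window_sum k U.
    by rewrite -E; ring.
  rewrite (le_trans (ler_normB _ _))// (le_trans (lerD (ler_normD _ _) (lexx _)))//.
  rewrite -addrA addrC lerD2r.
  rewrite (le_trans (lerD (norm_window_sum _ _) (norm_window_sum _ _)))//.
  by rewrite -natrD ler_nat; lia.
apply: le_trans (le_expect (law_on_zeta_iter n w) (fun U _ => near U)) _.
rewrite expectD (expect_cst _ (law_on_zeta_iter n w)) natrD -!addrA lerD2l.
rewrite -[w in leLHS](cat_take_drop J) expect_zeta_iter_cat.
pose B U := r%:R + (r * J)%:R + `|sum_in_blocks n (take J w) U|.
apply: (@le_trans _ _ (expect (zeta_iter n (take J w)) B)).
  apply: (le_expect (law_on_zeta_iter n (take J w))) => u /eqP su.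
  apply: (expect_le_cst (law_on_zeta_iter n (drop J w))) => v _.
  have h1 := window_sum_cat u v; have h2 := window_sum_blocks su.
  rewrite su -/A in h1; rewrite -/A size_takel// in h2; rewrite /B.
  set z := sum_in_blocks _ _ _ in h2 *.
  have -> : window_sum A (u ++ v) =
      (window_sum A (u ++ v) - window_sum A u) + (window_sum A u - z) + z by ring.
  by rewrite (le_trans (ler_normD _ _))// lerD// (le_trans (ler_normD _ _))// lerD.
rewrite /B !expectD !(expect_cst _ (law_on_zeta_iter n (take J w))).
rewrite -addrA lerD2l natrM mulrDr -addrA mulrC lerD2l -[J in leRHS](size_takel Jw).
by apply: expect_norm_sum_in_blocks => // x; rewrite ler_nat.
Qed.

End windows.

(** * Expected frequencies in the images of the letters *)

Section deviation.
Variables (r : nat) (g : seq bool -> R).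
Hypothesis g01 : forall u, 0 <= g u <= 1.
Hypothesis m_ge1 : (1 <= m)%N.

Notation N := (block_mean r g).

Let g_osc u v : `|g u - g v| <= 1.
Proof.
have /andP[u0 u1] := g01 u; have /andP[v0 v1] := g01 v.
by rewrite ler_norml; apply/andP; split; lra.
Qed.

Lemma block_mean_b n : N n.+1 false = N n true.
Proof.
by rewrite /block_mean expect_zeta_iterS expect_zeta_cons !expect_lret.
Qed.

(** [zeta a] has [m] letters [a] and one letter [b], and each of its [m + 1]
    letters contributes an error of at most [r] to the sum over the blocks. *)
Lemma block_mean_a n :
  `|N n.+1 true - (m%:R * N n true + N n false)| <= (r * m.+1)%:R.
Proof.
rewrite /block_mean expect_zeta_iterS expect_zeta_cons -!/(block_mean _ _ _ _).
rewrite -[X in _ - X](expect_cst _ (law_on_zeta_letter true)) -expectB.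
rewrite (le_trans (norm_expect _ (law_on_zeta_letter true)))//.
apply: (expect_le_cst (law_on_zeta_letter true)) => u ua.
rewrite expect_lret cats0 -(image_len_letter n ua).
have [/eqP ca /eqP cb] := andP ua.
have -> : m%:R * N n true + N n false = \sum_(x <- u) N n x.
  by rewrite sum_word ca cb mulr1n mulr_natl.
have -> : m.+1 = size u by rewrite -image_len0 (image_len_letter 0 ua)/= muln1 addn1.
rewrite -expect_sum_in_blocks -expectB (le_trans (norm_expect _ (law_on_zeta_iter n u)))//.
apply: (expect_le_cst (law_on_zeta_iter n u)) => U /eqP sU.
exact: window_sum_blocks.
Qed.

Lemma block_mean_bounds n x : 0 <= N n x <= (letter_len n x)%:R.
Proof.
have H := law_on_zeta_iter1 n x; apply/andP; split.
  rewrite -[leLHS](expect_cst _ H); apply: (le_expect H) => U _.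
  by apply: sumr_ge0 => i _; have /andP[] := g01 (take r (drop i U)).
apply: (expect_le_cst H) => U _.
rewrite -[X in _ <= X%:R]card_ord -sumr_const ler_sum// => i _.
by have /andP[] := g01 (take r (drop i U)).
Qed.

(** The pair of the means and the pair of the lengths obey the same linear
    recursion, of determinant [-1], but for the error of [block_mean_a], which
    adds at most [r * m.+1] times [letter_len n true] to the determinant.  The
    sum [letter_len n true + letter_len n false] grows by at least
    [letter_len n true] at each step, so it dominates the accumulated error. *)
Lemma block_mean_det n :
  `|N n true * (letter_len n false)%:R - N n false * (letter_len n true)%:R| <=
  (r.+1 * m.+1)%:R * (letter_len n true + letter_len n false)%:R.
Proof.
elim: n => [|n IHn].
  have /andP[a0 a1] := block_mean_bounds 0 true.
  have /andP[b0 b1] := block_mean_bounds 0 false.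
  rewrite /= ?mulr1n in a1 b1; rewrite /= !mulr1 -natrM.
  apply: (@le_trans _ _ 1); first by rewrite ler_norml; apply/andP; split; lra.
  by rewrite ler1n; lia.
rewrite block_mean_b -[letter_len n.+1 false]/(letter_len n true).
have := block_mean_a n; move: (N n.+1 true) => Na.
have -> : letter_len n.+1 true = (m * letter_len n true + letter_len n false)%N by [].
set A := N n true in IHn *; set B := N n false in IHn *.
set La := letter_len n true in IHn *; set Lb := letter_len n false in IHn *.
move=> hN; rewrite natrD natrM.
have -> : Na * La%:R - A * (m%:R * La%:R + Lb%:R) =
  (Na - (m%:R * A + B)) * La%:R - (A * Lb%:R - B * La%:R) by ring.
rewrite (le_trans (ler_normB _ _))// (le_trans (lerD (lexx _) IHn))//.
rewrite normrM normr_nat (le_trans (lerD (ler_wpM2r (ler0n _ _) hN) (lexx _)))//.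
rewrite -!natrM -natrD ler_nat.
have : (r * m.+1 * La <= r.+1 * m.+1 * (m * La))%N.
  by rewrite leq_mul ?leq_mul2r ?leqnSn ?orbT ?leq_pmull.
by rewrite !(mulnDr (r.+1 * m.+1)); lia.
Qed.

Lemma letter_len_ab n : (letter_len n false <= letter_len n true)%N.
Proof. by case: n => //= n; have := letter_len_gt0 n false; nia. Qed.

Lemma ltn_letter_len_b n : (n < letter_len n.+1 false)%N.
Proof.
elim: n => [|n IHn] //.
rewrite -[letter_len n.+2 false]/(m * letter_len n true + letter_len n false)%N.
by have := letter_len_gt0 n false; move: IHn; rewrite /=; nia.
Qed.

Definition block_freq n : R := N n true / (letter_len n true)%:R.

Lemma block_freq01 n : 0 <= block_freq n <= 1.
Proof.
have /andP[a0 a1] := block_mean_bounds n true.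
by rewrite /block_freq divr_ge0// ler_pdivrMr ?ltr0n ?letter_len_gt0// mul1r.
Qed.

(** The mean over [zeta^n a] vanishes by the choice of [block_freq], and the mean
    over [zeta^n b] is the determinant of [block_mean_det] divided by the length
    of [zeta^n a]. *)
Lemma block_mean_bias n x :
  `|block_mean r (fun u => g u - block_freq n) n x| <= (2 * (r.+1 * m.+1))%:R.
Proof.
have La0 : (letter_len n true)%:R != 0 :> R by rewrite pnatr_eq0 -lt0n letter_len_gt0.
have -> : block_mean r (fun u => g u - block_freq n) n x =
    N n x - block_freq n * (letter_len n x)%:R.
  rewrite /block_mean -[X in _ = _ - X](expect_cst _ (law_on_zeta_iter1 n x)) -expectB.
  apply: eq_expect => U; rewrite /window_sum sumrB sumr_const card_ord.
  by rewrite [X in _ = _ - X]mulr_natr.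
case: x; first by rewrite /block_freq divfK// subrr normr0.
have -> : N n false - block_freq n * (letter_len n false)%:R =
  - (N n true * (letter_len n false)%:R - N n false * (letter_len n true)%:R) /
    (letter_len n true)%:R.
  by rewrite /block_freq; field.
rewrite normrM normrN normfV normr_nat ler_pdivrMr ?ltr0n ?letter_len_gt0//.
rewrite (le_trans (block_mean_det n))// -!natrM ler_nat.
by rewrite [(2 * _)%N]mulnC -[leqRHS]mulnA leq_mul2l; have := letter_len_ab n; lia.
Qed.

(** The weak law, uniformly in the word [w] to which [zeta^n] is applied.  The
    length [n] is chosen first, so that boundary effects and bias are small
    relative to the length of a block; then [M], so that the fluctuations and
    the two ends of the window are small relative to [M]. *)
Lemma uniform_deviation (e : R) : 0 < e -> exists n M c, (0 < M)%N /\
  forall w, size w = (M + r)%N ->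
  iter n (transfer (M + r)) (fun u => M%:R^-1 * `|window_sum r (fun v => g v - c) M u|) w <=
  3 * e * (letter_len n (head a_ w))%:R.
Proof.
move=> e0; pose K := (2 * (r.+1 * m.+1))%N.
have [n nK] : exists n : nat, (r + K)%:R / e <= n%:R :> R.
  by exists (Num.truncn ((r + K)%:R / e)).+1; rewrite ltW// truncnS_gt.
set C : R := K%:R; set c := block_freq n.+1.
set L := letter_len n.+1 true; set Lmin := letter_len n.+1 false.
pose B : R := (3 * L + r)%:R + (L%:R *+ 2) ^+ 2 / e / 2.
have [M MB] : exists M : nat, B / e <= M%:R :> R.
  by exists (Num.truncn (B / e)).+1; rewrite ltW// truncnS_gt.
(* the shift by one in [n] makes the image of [b] longer than [n] *)
exists n.+1, M.+1, c; split=> // w sw.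
have B0 : 0 <= B by rewrite addr_ge0// !mulr_ge0 ?sqr_ge0 ?invr_ge0// ltW.
rewrite iter_transfer ?sw//; last by rewrite leqnn addSn.
rewrite /head_block_sum expect_sum.
have cf u v : `|g u - c - (g v - c)| <= 1.
  by rewrite (_ : _ - _ = g u - g v) ?g_osc//; ring.
have cf1 u : `|g u - c| <= 1.
  have /andP[c0 c1] := block_freq01 n.+1; have /andP[u0 u1] := g01 u.
  by rewrite ler_norml /c; apply/andP; split; lra.
rewrite -[letter_len n.+1 (head _ _) in leRHS]card_ord mulr_natr -sumr_const.
apply: ler_sum => k _.
have kL : (k <= L)%N.
  rewrite ltnW// (leq_trans (ltn_ord k))// /L; case: (head _ _) => //.
  exact: letter_len_ab.
have lenL x : (Lmin <= letter_len n.+1 x <= L)%N.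
  by case: x; rewrite !leqnn ?andbT/=; exact: letter_len_ab.
have eM : 0 < e * M.+1%:R by rewrite mulr_gt0.
have [|J [JL hJ]] := expect_norm_window_sum (r := r) cf cf1 lenL
  (block_mean_bias n.+1) eM (_ : (M.+1 <= size w)%N) kL.
  by rewrite sw leq_addr.
rewrite expectZ ler_pdivrMl//.
rewrite [leLHS](_ : _ = expect (zeta_iter n.+1 w)
    (fun U => `|window_sum r (fun v => g v - c) M.+1 (drop k U)|)); last first.
  apply: eq_expect => U; congr `|_|; apply: eq_bigr => i _; congr (g _ - _).
  rewrite [LHS]take_drop [RHS]take_drop take_takel//.
  by have := ltn_ord i; lia.
rewrite (le_trans hJ)//.
have JM : (J <= M.+1)%N.
  by rewrite (leq_trans _ JL)// leq_pmulr// letter_len_gt0.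
have J1 : J%:R * (r%:R + C) <= e * M.+1%:R.
  rewrite -natrD; apply: (@le_trans _ _ (J%:R * (e * Lmin%:R))).
    rewrite ler_wpM2l// -ler_pdivrMl// mulrC (le_trans nK)// ler_nat.
    exact: ltnW (ltn_letter_len_b n).
  by rewrite mulrCA ler_wpM2l ?(ltW e0)// -natrM ler_nat.
have J2 : J%:R * (L%:R *+ 2) ^+ 2 / (e * M.+1%:R) <= (L%:R *+ 2) ^+ 2 / e.
  rewrite ler_pdivrMr// [leRHS](_ : _ = M.+1%:R * (L%:R *+ 2) ^+ 2); last first.
    by field; rewrite gt_eqF.
  by rewrite ler_wpM2r ?sqr_ge0// ler_nat.
have J3 : B <= e * M.+1%:R.
  by rewrite mulrC -ler_pdivrMr// (le_trans MB)// ler_nat.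
rewrite /B in J3; rewrite -/C.
move: J1 J2 J3 eM; set x1 := J%:R * (r%:R + C); set x2 := _ / (e * _).
set x3 := _ / e; set x4 := (3 * L + r)%:R; set x5 := e * M.+1%:R.
have -> : M.+1%:R * (3 * e) = 3 * x5 by rewrite /x5; ring.
by clearbody x1 x2 x3 x4 x5; lra.
Qed.

End deviation.
End noble.

(** * The weak law for the windows of an eigenvector *)

Lemma lambda_sqr (R : realType) m : (lambda m : R) ^+ 2 = m%:R * lambda m + 1.
Proof.
have : Num.sqrt ((m%:R : R) ^+ 2 + 4) ^+ 2 = m%:R ^+ 2 + 4.
  by rewrite sqr_sqrtr// addr_ge0// sqr_ge0.
by rewrite /lambda; set s := Num.sqrt _ => h; rewrite expr_div_n sqrrD h; field.
Qed.

Lemma lambda_ge1 (R : realType) m : 1 <= (lambda m : R).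
Proof.
have : 2 <= Num.sqrt ((m%:R : R) ^+ 2 + 4).
  rewrite -[leLHS]ger0_norm// -sqrtr_sqr ler_sqrt ?addr_ge0 ?sqr_ge0//.
  by rewrite (_ : 2 ^+ 2 = 4 :> R) ?lerDr ?sqr_ge0//; ring.
by rewrite /lambda ler_pdivlMr// mul1r => h; rewrite (le_trans h)// lerDr.
Qed.

(** This bound is uniform in [n], which is what compensates the factor
    [lambda m ^+ n] produced by the iterated eigenvector equation. *)
Lemma letter_len_le_lambda (R : realType) m n x :
  (@letter_len m n x)%:R <= (lambda m : R) ^+ n.+1.
Proof.
have l1 := lambda_ge1 R m.
suff H : (@letter_len m n true)%:R <= (lambda m : R) ^+ n.+1 /\
    (@letter_len m n false)%:R <= (lambda m : R) ^+ n.
  by case: x; [exact: H.1|rewrite (le_trans H.2)// ler_weXn2l].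
elim: n => [|n [IHa IHb]]; first by rewrite /= expr0 expr1.
split=> //; rewrite [letter_len _ _]/= natrD natrM.
rewrite 2!exprS mulrA -expr2 lambda_sqr mulrDl mul1r lerD//.
by rewrite -mulrA ler_wpM2l// -exprS.
Qed.

Section pf.
Context {R : realType} {m : nat} (p : 'I_m.+1 -> R).
Hypothesis m_ge1 : (1 <= m)%N.
Hypothesis p_ge0 : forall i, 0 <= p i.
Hypothesis p_sum1 : \sum_i p i = 1.

(** The law [phi] of long windows inherits the uniform bound: the length of the
    image of the first letter cancels against [lambda m ^+ n], up to a factor
    [lambda m]. *)
Lemma window_deviation r (g : seq bool -> R) (e : R) :
  (forall u, 0 <= g u <= 1) -> 0 < e -> exists M c, (0 < M)%N /\
  forall phi : 'cV[R]_#|legal_words p (M + r)|,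
    normalised_pf_vector (subst_mx p (M + r)) (lambda m) phi ->
    \sum_i phi i 0 * (M%:R^-1 * `|window_sum r (fun v => g v - c) M (legal_word i)|) <= e.
Proof.
move=> g01 e0; have l1 := lambda_ge1 R m.
have l0 : 0 < (lambda m : R) by exact: lt_le_trans l1.
have e'0 : 0 < e / (3 * lambda m) by rewrite divr_gt0// mulr_gt0.
have [n [M [c [M0 H]]]] := uniform_deviation p_ge0 p_sum1 r g01 m_ge1 e'0.
exists M, c; split=> // phi [Mphi phi0 phi1].
set G := fun u => M%:R^-1 * _ in H.
have := eigenvector_iter_transfer p_ge0 p_sum1 n (ltW l0) Mphi
  (fun i => ltW (phi0 i)) (_ : forall u, 0 <= G u).
move=> /(_ _)/le_trans => K.
rewrite -(ler_pM2l (exprn_gt0 n l0)); apply: K => [u|].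
  by rewrite mulr_ge0.
rewrite -[leRHS]mulr1 -phi1 mulr_sumr ler_sum// => i _.
rewrite [leRHS]mulrC ler_wpM2l ?(ltW (phi0 i))//.
apply: le_trans (H _ _) _; first by rewrite /legal_word size_tuple.
apply: le_trans (ler_wpM2l _ (letter_len_le_lambda R m n _)) _.
  by rewrite mulr_ge0// ltW.
by rewrite exprSr le_eqVlt; apply/orP; left; apply/eqP; field; rewrite gt_eqF.
Qed.

End pf.

(** * Windows, translations and the Borel sigma-algebra of the full shift *)

Lemma size_window x k l : size (window x k l) = l.
Proof. by rewrite size_map size_iota. Qed.

Lemma nth_window x k l i : (i < l)%N -> nth false (window x k l) i = x (k + i%:Z).
Proof. by move=> il; rewrite (nth_map 0%N) ?size_iota// nth_iota. Qed.

Lemma window_sub x k l i r : (i + r <= l)%N ->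
  take r (drop i (window x k l)) = window x (k + i%:Z) r.
Proof.
move=> irl; apply: (@eq_from_nth _ false) => [|j].
  by rewrite size_take_min size_drop !size_window; lia.
rewrite size_take_min size_drop size_window => jr.
rewrite nth_take ?nth_drop ?nth_window -?addrA//; lia.
Qed.

Definition translate (k : int) (x : config) : config := fun i => x (i + k).

Lemma window_translate j x k l : window (translate j x) k l = window x (k + j) l.
Proof. by apply: eq_map => i; rewrite /translate addrAC. Qed.

Lemma iter_left_shift n x : iter n left_shift x = translate n%:Z x.
Proof.
elim: n => [|n IHn]; first by apply/funext => i; rewrite /translate addr0.
rewrite iterS IHn; apply/funext => i; rewrite /translate /left_shift.
by rewrite -addrA -intS.
Qed.

Lemma left_shift_powE k x : left_shift_pow k x = translate k x.
Proof.
case: k => n; rewrite /left_shift_pow; first exact: iter_left_shift.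
rewrite NegzE; elim: n.+1 => {n} [|n IHn].
  by apply/funext => i; rewrite /translate oppr0 addr0.
rewrite iterS IHn; apply/funext => i; rewrite /translate /left_shift_inv.
by congr (x _); lia.
Qed.

Lemma coordinate_open (i : int) (b : bool) :
  @open {ptws int -> bool} [set x | x i = b].
Proof.
have : @open {ptws int -> bool} ((fun x : {ptws int -> bool} => x i) @^-1` [set b]).
  apply: open_comp; last exact: discrete_open.
  by move=> x _; exact: (@proj_continuous int (fun=> bool) i x).
by [].
Qed.

Lemma measurable_coordinate (i : int) (b : bool) :
  measurable [set x : config | x i = b].
Proof. by apply: sub_sigma_algebra; exact: coordinate_open. Qed.

Lemma measurable_window k l (P : set (seq bool)) :
  measurable [set x : config | P (window x k l)].
Proof.
elim: l k P => [|l IHl] k P.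
  have [P0|nP0] := pselect (P [::]).
    by rewrite (_ : [set _ | _] = setT)//; apply/seteqP; split.
  by rewrite (_ : [set _ | _] = set0)//; apply/seteqP; split.
have cons x : window x k l.+1 = x k :: window x (k + 1) l.
  rewrite /window/= addr0; congr (_ :: _); rewrite (iotaDl 1 0) -map_comp.
  by apply: eq_map => i /=; congr (x _); lia.
rewrite (_ : [set _ | _] = \big[setU/set0]_(b : bool)
  ([set x : config | x k = b] `&` [set x | P (b :: window x (k + 1) l)])).
  apply: bigsetU_measurable => b _; apply: measurableI.
    exact: measurable_coordinate.
  exact: (IHl (k + 1) [set w | P (b :: w)]).
apply/seteqP; split => x; rewrite -bigcup_seq/=.
  by rewrite cons => Px; exists (x k) => //=; rewrite mem_index_enum.
by move=> [b _ [/= xb]]; rewrite cons xb.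
Qed.

(** The cylinders around [x] generate a filter that converges to [x]
    coordinatewise, hence in the product topology. *)
Lemma open_window (A : set {ptws int -> bool}) (x : {ptws int -> bool}) :
  open A -> A x ->
  exists n, forall y : config,
    window y (- n%:Z) n.*2.+1 = window x (- n%:Z) n.*2.+1 -> A y.
Proof.
move=> oA Ax.
pose F : set_system {ptws int -> bool} := [set B | exists n, forall y : config,
  window y (- n%:Z) n.*2.+1 = window x (- n%:Z) n.*2.+1 -> B y].
have mono n n' y : (n <= n')%N ->
    window y (- n'%:Z) n'.*2.+1 = window x (- n'%:Z) n'.*2.+1 ->
    window y (- n%:Z) n.*2.+1 = window x (- n%:Z) n.*2.+1.
  move=> nn' E; have sub z : window z (- n%:Z) n.*2.+1 =
      take n.*2.+1 (drop (n' - n) (window z (- n'%:Z) n'.*2.+1)).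
    by rewrite window_sub; [congr window; lia|lia].
  by rewrite !sub E.
have FF : Filter F.
  split; first by exists 0%N.
    move=> P Q [n1 H1] [n2 H2]; exists (maxn n1 n2) => y E; split.
      by apply/H1/(mono _ _ _ (leq_maxl n1 n2)).
    by apply/H2/(mono _ _ _ (leq_maxr n1 n2)).
  by move=> P Q PQ [n H]; exists n => y /H/PQ.
suff : F --> x by apply; exact: open_nbhs_nbhs.
apply/cvg_sup => i B [_ [[C _ <-] Cx sB]].
exists `|i|%N => y /(congr1 (fun w => nth false w (absz (i + `|i|)))) E.
apply: sB => /=; move: E; rewrite !nth_window; [|lia|lia].
by rewrite (_ : - _ + _ = i) => [->|]; last lia.
Qed.

(** Windows centered at the origin are nested, so that two such events can be read
    off a common window: this makes the family stable under intersection. *)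
Definition window_sets : set (set config) :=
  [set A | exists n (P : set (seq bool)),
    A = [set x | P (window x (- n%:Z) n.*2.+1)]].

(** Every open set is the countable union over [n] of the events that the window
    of radius [n] around the origin forces membership in it. *)
Lemma window_sets_generate : @measurable _ config = <<s window_sets >>.
Proof.
apply/seteqP; split; last first.
  apply: smallest_sub; first exact: sigma_algebra_measurable.
  by move=> A [n [P ->]]; exact: measurable_window.
apply: smallest_sub; first exact: smallest_sigma_algebra.
move=> A oA; rewrite (_ : A = \bigcup_n [set x : config |
  [set w | forall y : config, window y (- n%:Z) n.*2.+1 = w -> A y]
    (window x (- n%:Z) n.*2.+1)]).
  by apply: sigma_algebra_bigcup => n; apply: sub_sigma_algebra; exists n; eexists.
apply/seteqP; split=> x; first by move=> Ax; have [n H] := open_window oA Ax; exists n.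
by move=> [n _]; exact.
Qed.

Lemma window_setsI : setI_closed window_sets.
Proof.
move=> _ _ [n1 [P1 ->]] [n2 [P2 ->]].
pose n := maxn n1 n2.
pose sub i w : seq bool := take i.*2.+1 (drop (n - i) w).
have subE i x : (i <= n)%N ->
    sub i (window x (- n%:Z) n.*2.+1) = window x (- i%:Z) i.*2.+1.
  by move=> ni; rewrite /sub window_sub; [congr window; lia|lia].
exists n, [set w | P1 (sub n1 w) /\ P2 (sub n2 w)].
by apply/seteqP; split => x /=; rewrite !subE ?leq_maxl ?leq_maxr.
Qed.

Lemma measurable_translate k : measurable_fun setT (translate k).
Proof.
apply: (measurability window_sets window_sets_generate) => _ [_ [n [P ->]] <-].
rewrite setTI (_ : _ @^-1` _ = [set x | P (window x (- n%:Z + k) n.*2.+1)]).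
  exact: measurable_window.
by apply/seteqP; split => x /=; rewrite window_translate.
Qed.

Section hull.
Context {R : realType} {m : nat} (p : 'I_m.+1 -> R).

Lemma measurable_hull : measurable (hull p).
Proof.
rewrite (_ : hull p = \bigcap_l \bigcap_k ([set x | legal p (window x (Posz k) l)]
  `&` [set x | legal p (window x (Negz k) l)])).
  apply: bigcapT_measurable => l; apply: bigcapT_measurable => k.
  by apply: measurableI; exact: measurable_window.
apply/seteqP; split => x; first by move=> hx l _ k _; split; exact: hx.
by move=> H [k|k] l; have [] := H l I k I.
Qed.

Lemma hull_translate k x : hull p x -> hull p (translate k x).
Proof. by move=> hx i l; rewrite window_translate. Qed.

Lemma measurable_cylinder k v : measurable (cylinder p k v).
Proof.
apply: measurableI; first exact: measurable_hull.
exact: (measurable_window k (size v) [set v]).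
Qed.

End hull.

Lemma measurable_fun_window (R : realType) k l (F : seq bool -> R) :
  measurable_fun setT (fun x : config => F (window x k l)).
Proof.
move=> _ B _; rewrite setTI.
exact: (measurable_window k l (F @^-1` B)).
Qed.

Lemma mu_translate (R : realType) (mu : probability config R) (k : int) A :
  (forall B : set config, measurable B -> mu (left_shift @^-1` B) = mu B) ->
  measurable A -> mu (translate k @^-1` A) = mu A.
Proof.
move=> mu_shift; have pos n B : measurable B -> mu (translate n%:Z @^-1` B) = mu B.
  move=> mB; elim: n => [|n IHn].
    congr (mu _); apply/seteqP; split => x /=; by rewrite -iter_left_shift.
  rewrite -IHn -[RHS]mu_shift.
    congr (mu _); apply/funext => x /=; rewrite -!iter_left_shift iterSr//.
  rewrite -[X in measurable X]setTI; exact: measurable_translate.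
move=> mA; case: k => n; first exact: pos.
rewrite NegzE -(pos n.+1).
  congr (mu _); apply/funext => x /=; congr A; apply/funext => i.
  by rewrite /translate; congr (x _); lia.
rewrite -[X in measurable X]setTI; exact: measurable_translate.
Qed.

(** * Ergodicity of the measure on the hull *)

Section birkhoff_hull.
Context (R : realType) (m : nat) (p : 'I_m.+1 -> R).
Hypothesis m_ge1 : (1 <= m)%N.
Hypothesis p_gt0 : forall i, 0 < p i.
Hypothesis p_sum1 : \sum_i p i = 1.
Variable phi : forall l : nat, 'cV[R]_#|legal_words p l|.
Hypothesis phi_pf : forall l : nat, (1 <= l)%N ->
  normalised_pf_vector (subst_mx p l) (lambda m) (phi l).
Variable mu : probability config R.
Hypothesis mu_hull : mu (hull p) = 1%E.
Hypothesis mu_shift :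
  forall A : set config, measurable A -> mu (left_shift @^-1` A) = mu A.
Hypothesis mu_cylinder : forall l : nat, (1 <= l)%N ->
  forall (k : int) (i : 'I_#|legal_words p l|),
    mu (cylinder p k (legal_word i)) = (phi l i ord0)%:E.

Lemma hull_ae : {ae mu, forall x, hull p x}.
Proof.
exists (~` hull p); split => //; first exact: measurableC (measurable_hull p).
rewrite probability_setC; last exact: measurable_hull.
by rewrite [X in (1 - X)%E](_ : _ = 1%E)// subee.
Qed.

(** The cylinders of the legal words of length [l] partition the hull, which has
    full measure. *)
Lemma Rintegral_window k l (F : seq bool -> R) : (1 <= l)%N ->
  \int[mu]_x F (window x k l) = \sum_i phi l i 0 * F (legal_word i).
Proof.
move=> l1; pose Z (i : 'I_#|legal_words p l|) := cylinder p k (legal_word i).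
have mZ i : measurable (Z i) by exact: measurable_cylinder.
pose h x := \sum_(i < #|legal_words p l|) F (legal_word i) * \1_(Z i) x.
have Z1 i : L1 mu (fun x => F (legal_word i) * \1_(Z i) x).
  by apply: L1_Z; exact: integrable_indic.
have hF x : hull p x -> F (window x k l) = h x.
  move=> hx.
  have /= sw : size (window x k l) == l by rewrite size_window.
  have wl : Tuple sw \in legal_words p l by rewrite inE; apply/asboolP; exact: hx.
  pose i := enum_rank_in wl (Tuple sw).
  have iE : legal_word i = window x k l by rewrite /legal_word enum_rankK_in.
  rewrite /h (bigD1 i)//= big1 ?addr0.
    rewrite indicE mem_set ?mulr1 ?iE//; split => //.
    by rewrite iE size_window.
  move=> j /eqP ij; rewrite indicE memNset ?mulr0// => -[_ jE]; apply: ij.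
  apply/enum_val_inj/val_inj; rewrite /= -[LHS]/(legal_word j) -[RHS]/(legal_word i).
  by rewrite iE -jE size_tuple.
transitivity (\int[mu]_x h x).
  congr fine; apply: ae_eq_integral => //.
  - by apply/measurable_EFinP; exact: measurable_fun_window.
  - by apply: measurable_int; exact: L1_sum.
  - by apply: filterS hull_ae => x hx _; rewrite /= hF.
rewrite Rintegral_sum//; apply: eq_bigr => i _.
rewrite RintegralZl//; last exact: integrable_indic.
by rewrite Rintegral_indic// mulrC; congr (_ * _); rewrite [X in fine X]mu_cylinder.
Qed.

(** The average of the indicator over [M] steps is a function of a window of
    length [M + r], whose law is given by the eigenvector. *)
Lemma birkhoff_window_set A : window_sets A -> birkhoff mu left_shift \1_A.
Proof.
move=> [n [P ->]]; set k := - n%:Z; set r := n.*2.+1.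
pose g w : R := \1_P w.
have g01 w : 0 <= g w <= 1 by rewrite /g indicE; case: (_ \in _); rewrite lexx ler01.
rewrite (_ : \1__ = fun x => g (window x k r)); last first.
  apply/funext => x; rewrite /g !indicE.
  by congr (_%:R); apply/idP/idP; rewrite !inE.
apply: (@birkhoff_bounded _ _ _ mu left_shift _ _ _ 1).
- exact: (measurable_translate 1).
- exact: mu_shift.
- exact: measurable_fun_window.
- by move=> x; have /andP[g0 g1] := g01 (window x k r); rewrite ger0_norm.
move=> e e0.
have [M [c [M0 H]]] := window_deviation m_ge1 (fun i => ltW (p_gt0 i)) p_sum1 r g01 e0.
exists M, c; split => //.
have l1 : (1 <= M + r)%N by rewrite addn_gt0 M0.
apply: le_trans (H _ (phi_pf l1)).
rewrite -(Rintegral_window k (fun u => M%:R^-1 * `|window_sum r (fun v => g v - c) M u|))//.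
rewrite le_eqVlt; apply/orP; left; apply/eqP; apply: eq_Rintegral => x _.
rewrite -[X in X * _]ger0_norm ?invr_ge0// -normrM; congr `|_|.
rewrite /window_sum sumrB sumr_const card_ord mulrBr -[X in _ = _ - _ * X]mulr_natl.
rewrite mulKf ?pnatr_eq0 -?lt0n//; congr (_ * _ - _); apply: eq_bigr => i _.
rewrite window_sub; last by have := ltn_ord i; lia.
by rewrite iter_left_shift window_translate.
Qed.

Lemma birkhoff_hull (f : config -> R) : mu.-integrable (hull p) (EFin \o f) ->
  {ae mu, forall x : config, hull p x ->
    avg left_shift f ^~ x @ \oo --> \int[mu]_(y in hull p) f y}.
Proof.
move=> f1; have f1' : L1 mu (f \_ (hull p)).
  move: f1; rewrite (integrable_mkcond _ (measurable_hull p)).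
  by rewrite restrict_EFin.
have := birkhoff_generated (mu := mu) (tau := left_shift) (measurable_translate 1)
  mu_shift window_sets_generate window_setsI birkhoff_window_set f1'.
apply: filterS => x fx hx; rewrite Rintegral_mkcond.
rewrite (_ : avg left_shift f ^~ x = avg left_shift (f \_ (hull p)) ^~ x)//.
apply/funext => N; congr (_ * _); apply: eq_bigr => j _.
by rewrite iter_left_shift patchE mem_set//; exact: hull_translate.
Qed.

End birkhoff_hull.

Theorem theorem1 (R : realType) (m : nat) (p : 'I_m.+1 -> R)
  (m_ge1 : (1 <= m)%N)
  (p_gt0 : forall i, 0 < p i)
  (p_sum1 : \sum_i p i = 1)
  (phi : forall l : nat, 'cV[R]_#|legal_words p l|)
  (phi_pf : forall l : nat, (1 <= l)%N ->
     normalised_pf_vector (subst_mx p l) (lambda m) (phi l))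
  (mu : probability config R)
  (mu_hull : mu (hull p) = 1%E)
  (mu_shift : forall A : set config, measurable A -> mu (left_shift @^-1` A) = mu A)
  (mu_cylinder : forall l : nat, (1 <= l)%N ->
     forall (k : int) (i : 'I_#|legal_words p l|),
       mu (cylinder p k (legal_word i)) = (phi l i ord0)%:E)
  (f : config -> R)
  (f_L1 : mu.-integrable (hull p) (EFin \o f))
  (s : int) :
  {ae mu, forall x : config, hull p x ->
     (fun N : nat => N%:R^-1 * \sum_(j < N) f (left_shift_pow (s + j%:Z) x)) @ \oo
       --> \int[mu]_(y in hull p) f y}.
Proof.
have [Z [mZ Z0 ZP]] := birkhoff_hull m_ge1 p_gt0 p_sum1 phi_pf mu_hull mu_shift
  mu_cylinder f_L1.
(* the averages from time [s] at [x] are those from time [0] at [translate s x] *)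
exists (translate s @^-1` Z); split.
- rewrite -[X in measurable X]setTI; exact: measurable_translate.
- by rewrite -[RHS]Z0; exact: mu_translate.
move=> x nx; apply: contrapT => nZ; apply: nx => hx.
rewrite (_ : (fun N : nat => _) = avg left_shift f ^~ (translate s x)).
  apply: contrapT => nf; apply: nZ; apply: ZP => /= H; apply: nf; apply: H.
  exact: hull_translate.
apply/funext => N; congr (_ * _); apply: eq_bigr => j _.
rewrite left_shift_powE iter_left_shift; congr f; apply/funext => i.
by rewrite /translate; congr (x _); lia.
Qed.
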